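(* For every $n\ge 4$, the generalized $4$-connectivity of the $n$-dimensional dual cube satisfies $\kappa_4(D_n)=n-1$.
   Context: The $n$-dimensional dual cube $D_n$ has vertex set all $(2n-1)$-bit binary strings $u_1u_2\cdots u_{2n-1}$. Two vertices $u,v$ are adjacent iff they differ in exactly one bit position $i$, and moreover: if $1\le i\le n-1$ then $u_{2n-1}=v_{2n-1}=0$; if $n\le i\le 2n-2$ then $u_{2n-1}=v_{2n-1}=1$; (if $i=2n-1$ there is no further condition). It is $n$-regular. For a graph $G$ and $S\subseteq V(G)$, $\kappa_G(S)$ is the maximum number $m$ of trees $T_1,\dots,T_m$ in $G$, each containing all vertices of $S$, that are pairwise edge-disjoint and satisfy $V(T_i)\cap V(T_j)=S$ for all $i\ne j$. For $2\le r\le |V(G)|$, the generalized $r$-connectivity is $\kappa_r(G)=\min\{\kappa_G(S): S\subseteq V(G),\ |S|=r\}$. *)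

(* Defs.v *)
From mathcomp Require Import all_boot.
Set Implicit Arguments. Unset Strict Implicit. Unset Printing Implicit Defensive.

Section GenConn.
Variable T : finType.
Variable adj : rel T.

Definition erel (ET : {set {set T}}) : rel T := fun a b => [set a; b] \in ET.

Definition is_subgraph (VT : {set T}) (ET : {set {set T}}) : bool :=
  [forall e in ET, exists x, exists y,
     [&& x \in VT, y \in VT, adj x y & e == [set x; y]]].

Definition sub_connected (VT : {set T}) (ET : {set {set T}}) : bool :=
  [forall x in VT, forall y in VT, connect (erel ET) x y].

(* a cycle: a sequence of >= 3 distinct vertices, consecutive ones (cyclically) adjacent
   in the subgraph; such a sequence has length <= #|T| *)
Definition sub_acyclic (ET : {set {set T}}) : bool :=
  ~~ [exists k : 'I_#|T|.+1, exists t : k.-tuple T,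
        [&& 2 < k, uniq t & cycle (erel ET) t]].

Definition is_tree (VT : {set T}) (ET : {set {set T}}) : bool :=
  [&& VT != set0, is_subgraph VT ET, sub_connected VT ET & sub_acyclic ET].

Definition has_S_trees (S : {set T}) (m : nat) : bool :=
  [exists VT : {ffun 'I_m -> {set T}}, exists ET : {ffun 'I_m -> {set {set T}}},
     [forall i, is_tree (VT i) (ET i) && (S \subset VT i)] &&
     [forall i, forall j, (i != j) ==>
        ([disjoint ET i & ET j] && (VT i :&: VT j == S))]].

(* kappa_G(S): the maximum such m.  For #|S| >= 2 each tree has an edge, the edge
   sets are pairwise disjoint nonempty subsets of {set T}, so m <= #|{set T}|
   and the bounded max is the true max. *)
Definition kappaS (S : {set T}) : nat :=
  \max_(m < #|{set T}|.+1 | has_S_trees S m) m.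

Definition kappa_r (r : nat) : nat :=
  \big[minn/#|{set T}|]_(S : {set T} | #|S| == r) kappaS S.

End GenConn.

(* Dual cube D_n: vertices are (2n-1)-bit strings u_1..u_{2n-1}, stored 0-based:
   bit u_{k+1} is u at index k, k < 2n-1.  The last bit u_{2n-1} is index 2n-2. *)
Definition dc_vertex (n : nat) := {ffun 'I_(2 * n).-1 -> bool}.

Definition dc_adj (n : nat) : rel (dc_vertex n) := fun u v =>
  [exists i : 'I_(2 * n).-1,
     [forall j, (u j == v j) == (j != i)] &&
     [forall k : 'I_(2 * n).-1, (val k == (2 * n).-2) ==>
        (if val i < n.-1 then ~~ u k && ~~ v k
         else if val i < (2 * n).-2 then u k && v k
         else true)]].

(* Main.v *)
Require Import Defs.
From mathcomp Require Import all_boot.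
Set Implicit Arguments. Unset Strict Implicit. Unset Printing Implicit Defensive.

(** Upper bound: n trees through two adjacent terminals u and v would use every
    edge at u and at v exactly once, so the tree containing the edge uv could not
    reach a third terminal.

    Lower bound: let k = n - 1.  Fixing the class bit and the k bits that are frozen
    in that class gives a cluster, which is a k-cube, and any two clusters of
    different classes are joined by exactly one edge.  If the clusters without
    terminals are coloured with k colours, those of one colour therefore form a
    connected hub.  It remains to join each terminal, for each colour, to the hub of
    that colour by a path inside its own cluster followed by a cross edge, paths of
    different colours meeting only in terminals.  This is a problem about a single
    k-cube with four marked points (terminals, and exits leading to clusters with
    terminals).  A coordinate that is constant on the marks, or agrees with another
    one up to complement, can be removed: after subdivision the smaller cube embeds
    in the larger one, and enough room is left for one more colour.  Only k = 3 and
    the case of distinct nonconstant coordinates (k <= 7) remain, and these are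
    settled by a verified search. *)

(** * Spanning trees *)

Section SpanningTree.
Variables (T : finType) (adj : rel T).

Lemma erel_sym (E : {set {set T}}) : symmetric (erel E).
Proof. by move=> x y; rewrite /erel setUC. Qed.

Lemma sub_connected_root (E : {set {set T}}) (r : T) (V : {set T}) :
  {in V, forall v, connect (erel E) r v} -> sub_connected V E.
Proof.
move=> cV; apply/forall_inP => x xV; apply/forall_inP => y yV.
apply: connect_trans (cV _ yV).
by rewrite (sym_connect_sym (@erel_sym E)); apply: cV.
Qed.

Lemma set2_inj_l (x y z : T) : [set x; y] = [set x; z] -> y = z.
Proof.
move=> /setP e; move: (e y) (e z); rewrite !inE !eqxx !orbT.
by move=> /esym/orP[/eqP->|/eqP//] /orP[/eqP->|/eqP->].
Qed.

Lemma rel_set2 (R : rel T) (x y a b : T) :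
  symmetric R -> [set x; y] = [set a; b] -> R a b -> R x y.
Proof.
move=> Rs /setP e; move: (e a) (e b) (e x) (e y); rewrite !inE !eqxx !orbT.
case/orP=> /eqP e1; case/orP=> /eqP e2; case/esym/orP=> /eqP e3; case/esym/orP=> /eqP e4;
by subst; rewrite // Rs.
Qed.

(** The rest of the cycle, [p] followed by [x], still joins [y] to [x]; it does not use the edge
    [xy] because the vertices are distinct and [p] is nonempty. *)
Lemma connect_remove_cycle_edge (E : {set {set T}}) (x y : T) (p : seq T) :
  uniq [:: x, y & p] -> p != [::] -> cycle (erel E) [:: x, y & p] ->
  subrel (connect (erel E)) (connect (erel (E :\ [set x; y]))).
Proof.
move=> /=; rewrite inE negb_or => /andP[/andP[xy xp]] /andP[yp up] p0 /andP[exy pth].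
have yx : connect (erel (E :\ [set x; y])) y x.
  apply/connectP; exists (rcons p x); last by rewrite last_rcons.
  case: p p0 xp yp up pth => // z p _; rewrite !inE !negb_or /=.
  move=> /andP[xz xp] /andP[yz yp] _ /andP[eyz pth]; apply/andP; split.
    rewrite /erel in_setD1 [_ \in E]eyz andbT; apply: contra xz => /eqP.
    by rewrite [in X in _ = X]setUC => /set2_inj_l ->.
  apply: (sub_in_path (P := predC1 y)) pth.
    move=> a b /= ay by_ eab; rewrite /erel in_setD1 [_ \in E]eab andbT.
    apply/negP => /eqP/setP/(_ y); rewrite !inE eqxx orbT.
    by rewrite !(eq_sym y) (negbTE ay) (negbTE by_).
  rewrite /= eq_sym yz /= all_rcons /= xy /=.
  by apply/allP => w wp; apply: contra yp => /eqP <-.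
apply: connect_sub => a b eab; have [e|ne] := eqVneq [set a; b] [set x; y].
  have xy' : connect (erel (E :\ [set x; y])) x y.
    by rewrite (sym_connect_sym (@erel_sym _)).
  have /setP/(_ a) := e; have /setP/(_ b) := e; rewrite !inE !eqxx orbT /=.
  case/esym/orP => /eqP ->; case/esym/orP => /eqP -> //; exact: connect0.
by apply: connect1; rewrite /erel in_setD1 ne.
Qed.

Lemma component_spanning_tree (R : rel T) (r : T) :
  symmetric R -> subrel R adj ->
  exists E : {set {set T}},
    is_tree adj [set v | connect R r v] E /\
    (forall e, e \in E -> exists u v, e = [set u; v] /\ R u v).
Proof.
move=> Rs Ra; set V := [set v | _].
pose E0 := [set e | [exists u in V, exists v in V, R u v && (e == [set u; v])]].
pose P (E : {set {set T}}) := (E \subset E0) && [forall v in V, connect (erel E) r v].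
have rV : r \in V by rewrite inE connect0.
have PE0 : P E0.
  rewrite /P subxx; apply/forall_inP => v; rewrite inE => /connectP[p pth ->].
  apply/connectP; exists p => //; elim: p {v} (r) rV pth => //= y p IH x xV /andP[Rxy pth].
  have yV : y \in V by move: xV; rewrite !inE => xV; apply: connect_trans xV (connect1 Rxy).
  rewrite IH // andbT /erel inE; apply/exists_inP; exists x => //.
  by apply/exists_inP; exists y; rewrite // Rxy eqxx.
have [E mE _] := minset_exists PE0; have PE := minsetp mE.
case/andP: PE => sE /forall_inP cE; exists E; split; last first.
  move=> e /(subsetP sE); rewrite inE => /exists_inP[u _ /exists_inP[v _ /andP[Ruv /eqP ->]]].
  by exists u, v.
apply/and4P; split.
- by apply/set0Pn; exists r.
- apply/forall_inP => e /(subsetP sE); rewrite inE.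
  case/exists_inP => u uV /exists_inP[v vV /andP[Ruv /eqP->]].
  by apply/existsP; exists u; apply/existsP; exists v; rewrite uV vV Ra /=.
- exact: sub_connected_root cE.
apply/negP => /existsP[k /existsP[t /and3P[k2 ut ct]]].
case: t ut ct => -[|x [|y p]] /= /eqP sz; rewrite ?{1}sz //; rewrite -sz // in k2.
move=> ut ct; have p0 : p != [::] by case: p sz ut ct k2.
have sub := connect_remove_cycle_edge ut p0 ct.
have exy : [set x; y] \in E by move: ct => /= /andP[].
have PE' : P (E :\ [set x; y]).
  rewrite /P (subset_trans (subsetDl _ _) sE); apply/forall_inP => v vV.
  exact/sub/cE.
have := minsetinf mE PE' (subsetDl _ _) => /setP/(_ [set x; y]).
by rewrite !inE eqxx exy.
Qed.

Lemma connect_last_step (R : rel T) (s v : T) :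
  connect R s v -> s = v \/ exists u, R u v.
Proof.
case/connectP=> p; case/lastP: p => [|p z] /=; first by left.
by rewrite rcons_path last_rcons => /andP[_ Rz] ->; right; eexists; apply: Rz.
Qed.

(** Each relation contributes a spanning tree of its component of [r]. A vertex other than [r] in
    two such components has an incident edge in both relations, hence lies in [S]. *)
Lemma has_S_trees_of_rels (S : {set T}) (m : nat) (R : 'I_m -> rel T) :
  S != set0 -> (forall i, symmetric (R i)) -> (forall i, subrel (R i) adj) ->
  (forall i j u v w, i != j -> R i u v -> R j u w -> u \in S) ->
  (forall i j u v, i != j -> R i u v -> ~~ R j u v) ->
  (forall i, {in S &, forall s t, connect (R i) s t}) ->
  has_S_trees adj S m.
Proof.
move=> /set0Pn[r rS] Rs Ra Rv Re Rc.
have /fin_all_exists[E HE] i := component_spanning_tree r (Rs i) (Ra i).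
apply/existsP; exists [ffun i => [set v | connect (R i) r v]].
apply/existsP; exists [ffun i => E i]; apply/andP; split.
  apply/forallP => i; rewrite !ffunE (proj1 (HE i)); apply/subsetP => s sS.
  by rewrite inE Rc.
apply/forallP => i; apply/forallP => j; apply/implyP => ij; rewrite !ffunE.
apply/andP; split.
  apply/pred0P => e /=; apply/negP => /andP[ei ej].
  have [u [v [eE Ruv]]] := proj2 (HE i) _ ei.
  have [u' [v' [eE' Ruv']]] := proj2 (HE j) _ ej.
  have Rj : R j u v := rel_set2 (Rs j) (etrans (esym eE) eE') Ruv'.
  by move: (Re _ _ _ _ ij Ruv); rewrite Rj.
rewrite eqEsubset; apply/andP; split; apply/subsetP => v; last first.
  by move=> vS; rewrite !inE !Rc.
rewrite !inE => /andP[/connect_last_step[<-//|[u Ru]] /connect_last_step[<-//|[w Rw]]].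
by apply: (Rv i j v u w); rewrite // Rs.
Qed.

End SpanningTree.

(** * Searching for path systems on bit vectors *)

Definition bits := seq bool.
(* A leg (a, c, q) is the path of colour c that starts at a and continues with q. *)
Definition leg := (bits * nat * seq bits)%type.

Definition bflip (r : nat) (v : bits) : bits := set_nth false v r (~~ nth false v r).

Definition badj (v w : bits) : bool := has (fun r => w == bflip r v) (iota 0 (size v)).

Definition leg_ok (F A : seq bits) (e : leg) : bool :=
  let: (a, c, q) := e in
  [&& path badj a q, last a q \notin F & all (fun v => v \notin A) q].

(* Written with [if] and not [&&]: [vm_compute] evaluates both sides of [&&]. *)
Definition compat (sep : bool) (e f : leg) : bool :=
  let: (a, c, q) := e in let: (b, d, r) := f in
  if c == d then true else
  if last a q == last b r then false else
  if sep && (a != b) then true else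
  if all (fun v => if v \in b :: r then (v == a) || (v == b) else true) (a :: q)
  then if a == b then true else ~~ ((b \in q) && (a \in r)) else false.

Definition extend (k : nat) (A : seq bits) (a : bits) (q : seq bits) : seq (seq bits) :=
  [seq rcons q v | v <- [seq v <- [seq bflip r (last a q) | r <- iota 0 k]
                             | (v \notin a :: q) && (v \notin A)]].

(** Breadth first: all tails of at most [n] further steps, shorter ones first, so that short paths
    are tried first. *)
Fixpoint tails (n k : nat) (A : seq bits) (a : bits) (front : seq (seq bits)) :=
  if n is n'.+1 then front ++ tails n' k A a (flatten [seq extend k A a q | q <- front])
  else front.

Definition candidates (n k : nat) (F A : seq bits) (a : bits) : seq (seq bits) :=
  [seq q <- tails n k A a [:: [::]] | last a q \notin F].

Fixpoint search (sep : bool) (tasks : seq (bits * nat * seq (seq bits))) (acc : seq leg) : option (seq leg) :=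
  if tasks is (a, c, qs) :: ts then
    (fix try l := if l is q :: l' then
       if all (compat sep (a, c, q)) acc then
         if search sep ts ((a, c, q) :: acc) is Some r then Some r else try l'
       else try l'
     else None) qs
  else Some acc.

(* The r-th number of s is the type of coordinate r: its bits tell which of the
   marks 1, 2, 3 differ from mark 0 there.  Mark 0 is placed at the origin. *)
Definition marks_of (s : seq nat) : seq bits :=
  [:: nseq (size s) false; [seq odd c | c <- s]; [seq odd c./2 | c <- s]; [seq odd c./2./2 | c <- s]].

Definition verify (k : nat) (P F A : seq bits) (sep : bool) (sol : seq leg) : bool :=
  [&& all (fun a => all (fun c => has (fun e : leg => (e.1.1 == a) && (e.1.2 == c)) sol) (iota 0 k)) P,
      all (leg_ok F A) sol & all (fun e => all (compat sep e) sol) sol].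

(* The search itself needs no correctness proof, as its output is verified.
   Treating the terminals one after the other keeps the backtracking small;
   legs with three steps are needed only in dimension 3. *)
Definition solvable (pn fn : nat) (av sep : bool) (s : seq nat) : bool :=
  let k := size s in let M := marks_of s in
  let P := take pn M in let F := drop fn M in let A := if av then F else [::] in
  let tasks := flatten [seq (let qs := candidates (if k == 3 then 3 else 2) k F A a in
                            [seq (a, c, qs) | c <- iota 0 k]) | a <- undup P] in
  if search sep tasks [::] is Some sol then verify k P F A sep sol else false.

(** Types are numbers below 8. Dimension 3 is the bottom of the reduction, so repetitions and type 0
    remain; only the order of the coordinates is factored out. *)
Definition codes3 := flatten [seq [seq [:: a; b; c] | b <- iota a (8 - a), c <- iota b (8 - b)] | a <- iota 0 8].
Fixpoint subs (l : seq nat) : seq (seq nat) := if l is x :: l' then [seq x :: s | s <- subs l'] ++ subs l' else [:: [::]].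
(** Above dimension 3 the reduction stops only at distinct nonzero types, that is, at a set of at
    least four of the seven nonzero types. *)
Definition codesI := [seq s <- subs (iota 1 7) | 3 < size s].
(* Fails when exactly one coordinate is nonconstant, of type 3 or 5: then the
   terminals 0 and 1 are adjacent and are also the two forbidden points 2 and 3.
   Each has too few exits left, so this case has no solution. *)
Definition not_crossed (s : seq nat) : bool :=
  ~~ ((count_mem 0 s == (size s).-1) && ((3 \in s) || (5 \in s))).

(** * Path systems in cubes *)

Section Fans.
Variable I : finType.
Implicit Types (u v w a b : {set I}) (J : {set I}) (P F A : seq {set I}).

Definition flip (j : I) (u : {set I}) : {set I} := [set x | (x == j) (+) (x \in u)].

Definition qadj (J : {set I}) : rel {set I} := fun u v => [exists j in J, v == flip j u].

(* P is the set of terminals, F the set of points where no path may end, A the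
   set of points that the paths avoid, and J serves both as the set of
   coordinates and as the set of colours: [a :: p a i] is the path of colour i
   from a.  With [sep], the terminals live in different copies of the cube, so
   only the end points of paths from distinct terminals matter. *)
Record fan_system (J : {set I}) (P F A : seq {set I}) (sep : bool)
    (p : {set I} -> I -> seq {set I}) : Prop := FanSystem {
  fan_path : forall a i, a \in P -> i \in J -> path (qadj J) a (p a i);
  fan_exit : forall a i, a \in P -> i \in J -> last a (p a i) \notin F;
  fan_avoid : forall a i v, a \in P -> i \in J -> v \in p a i -> v \notin A;
  fan_exit_neq : forall a b i j, a \in P -> b \in P -> i \in J -> j \in J -> i != j ->
    last a (p a i) != last b (p b j);
  fan_meet : forall a b i j v, a \in P -> b \in P -> i \in J -> j \in J -> i != j ->
    (sep -> a = b) -> v \in a :: p a i -> v \in b :: p b j -> v = a \/ v = b;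
  fan_cross : forall a b i j, a \in P -> b \in P -> i \in J -> j \in J -> i != j ->
    ~~ sep -> a != b -> b \in p a i -> a \notin p b j }.

Lemma flipK j : involutive (flip j).
Proof. by move=> u; apply/setP => x; rewrite !inE addKb. Qed.

Lemma flip_neq j u : flip j u != u.
Proof. by apply/eqP => /setP/(_ j); rewrite !inE eqxx; case: (j \in u). Qed.

Lemma in_flip_neq i j u : i != j -> (i \in flip j u) = (i \in u).
Proof. by rewrite inE => /negbTE->. Qed.

Lemma in_flip i u : (i \in flip i u) = (i \notin u).
Proof. by rewrite inE eqxx. Qed.

Lemma qadj_sym J : symmetric (qadj J).
Proof.
by move=> u v; apply/exists_inP/exists_inP => -[j jJ /eqP->]; exists j; rewrite ?flipK.
Qed.

Lemma qadj_flip J j u : j \in J -> qadj J u (flip j u).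
Proof. by move=> jJ; apply/exists_inP; exists j. Qed.

Lemma qadj_irr J u v : qadj J u v -> u != v.
Proof. by case/exists_inP=> j _ /eqP->; rewrite eq_sym flip_neq. Qed.

Lemma qadj_fixed J i u v : i \notin J -> qadj J u v -> (i \in v) = (i \in u).
Proof.
move=> iJ /exists_inP[j jJ /eqP->]; rewrite in_flip_neq //.
by apply: contraNneq iJ => ->.
Qed.

Lemma path_fixed J i a q v : i \notin J -> path (qadj J) a q -> v \in a :: q ->
  (i \in v) = (i \in a).
Proof.
move=> iJ; elim: q a => [|b q IH] a /=; first by rewrite inE => _ /eqP->.
move=> /andP[ab pth]; rewrite inE => /orP[/eqP->//|vq].
by rewrite (IH _ pth vq) (qadj_fixed iJ ab).
Qed.

(* The cube of dimension |J| is embedded by phi in the cube of dimension |J| + 1,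
   the edge uv being subdivided by st u v.  The new colour i is served by the
   neighbour nb a of each terminal a, which lies off the image. *)
Section Lift.
Variables (J : {set I}) (i : I).
Hypothesis iJ : i \notin J.
Let J1 := i |: J.
Variables (phi : {set I} -> {set I}) (st : {set I} -> {set I} -> seq {set I}) (nb : {set I} -> {set I}).
Hypothesis phiK : forall u, i \notin u -> phi u :\ i = u.
Hypothesis st_path : forall u v, i \notin u -> qadj J u v ->
  path (qadj J1) (phi u) (rcons (st u v) (phi v)).
Hypothesis st_phi : forall u v w, i \notin u -> qadj J u v -> i \notin w -> phi w \notin st u v.
Hypothesis st_nb : forall u v w, i \notin u -> qadj J u v -> i \notin w -> nb w \notin st u v.
Hypothesis st_inj : forall u v u' v' w, i \notin u -> i \notin u' -> qadj J u v -> qadj J u' v' ->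
  w \in st u v -> w \in st u' v' -> (u = u' /\ v = v') \/ (u = v' /\ v = u').
Hypothesis nb_adj : forall u, i \notin u -> qadj J1 (phi u) (nb u).
Hypothesis nb_phi : forall u w, i \notin u -> i \notin w -> nb u != phi w.

Let phi_inj u v : i \notin u -> i \notin v -> phi u = phi v -> u = v.
Proof. by move=> iu iv e; rewrite -(phiK iu) e phiK. Qed.

Fixpoint subdivide (u : {set I}) (q : seq {set I}) : seq {set I} :=
  if q is v :: q' then st u v ++ phi v :: subdivide v q' else [::].

Lemma last_subdivide u q : last (phi u) (subdivide u q) = phi (last u q).
Proof. by elim: q u => //= v q IH u; rewrite last_cat /= IH. Qed.

Lemma path_subdivide u q : i \notin u -> path (qadj J) u q ->
  path (qadj J1) (phi u) (subdivide u q).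
Proof.
elim: q u => //= v q IH u iu /andP[uv pth]; rewrite -cat_rcons cat_path last_rcons.
by rewrite st_path // IH // (qadj_fixed iJ uv).
Qed.

Lemma mem_subdivide u q v : path (qadj J) u q -> v \in subdivide u q ->
  (exists2 w, w \in q & v = phi w) \/
  (exists x y, [/\ x \in u :: q, y \in u :: q, qadj J x y & v \in st x y]).
Proof.
elim: q u => //= w q IH u /andP[uw pth]; rewrite mem_cat inE => /or3P[vs|/eqP->|vq].
- by right; exists u, w; rewrite !inE !eqxx orbT.
- by left; exists w; rewrite ?inE ?eqxx.
case: (IH _ pth vq) => [[z zq ->]|[x [y [xq yq xy vs]]]].
  by left; exists z; rewrite // inE zq orbT.
by right; exists x, y; split=> //; rewrite inE ?xq ?yq orbT.
Qed.

Lemma phi_mem_subdivide u q v : i \notin u -> i \notin v -> path (qadj J) u q ->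
  phi v \in subdivide u q -> v \in q.
Proof.
move=> iu iv pth vq; have dom w : w \in u :: q -> i \notin w.
  by move=> wq; rewrite (path_fixed iJ pth wq).
case: (mem_subdivide pth vq) => [[w wq e]|[x [y [xq _ xy]]]].
  by rewrite (phi_inj iv _ e) // dom // inE wq orbT.
by rewrite (negbTE (st_phi (dom _ xq) xy iv)).
Qed.

Lemma fan_lift P F A sep p :
  {in P ++ F ++ A, forall u, i \notin u} -> fan_system J P F A sep p ->
  exists p1, fan_system J1 (map phi P) (map phi F) (map phi A) sep p1.
Proof.
move=> dom fp.
have domP a : a \in P -> i \notin a by move=> aP; apply: dom; rewrite mem_cat aP.
have domF a : a \in F -> i \notin a by move=> aP; apply: dom; rewrite !mem_cat aP orbT.
have domA a : a \in A -> i \notin a by move=> aP; apply: dom; rewrite !mem_cat aP !orbT.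
have domp a c v : a \in P -> c \in J -> v \in a :: p a c -> i \notin v.
  by move=> aP cJ /(path_fixed iJ (fan_path fp aP cJ))->; apply: domP.
have doml a c : a \in P -> c \in J -> i \notin last a (p a c).
  by move=> aP cJ; apply: domp (mem_last _ _).
(* [a :\ i] recovers the point whose image is [a]. The old colours follow the subdivided path, the
   new colour takes the single step to [nb]. *)
pose p1 a c := if c == i then [:: nb (a :\ i)] else subdivide (a :\ i) (p (a :\ i) c).
have p1i a : a \in P -> p1 (phi a) i = [:: nb a] by move=> aP; rewrite /p1 eqxx phiK ?domP.
have p1J a c : a \in P -> c \in J -> p1 (phi a) c = subdivide a (p a c).
  by move=> aP cJ; rewrite /p1 (negbTE (memPn iJ _ cJ)) phiK ?domP.
have nb_sub a b c : i \notin a -> b \in P -> c \in J -> nb a \notin phi b :: subdivide b (p b c).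
  move=> ia bP cJ; rewrite inE (negbTE (nb_phi ia (domP _ bP))) /=; apply/negP => nq.
  case: (mem_subdivide (fan_path fp bP cJ) nq) => [[w wq /eqP]|[x [y [xq _ xy]]]].
    by rewrite (negbTE (nb_phi _ _)) // (domp b c) // inE wq orbT.
  by rewrite (negbTE (st_nb _ _ _)) // (domp b c).
exists p1; split.
- move=> _ c /mapP[a aP ->] /setU1P[->|cJ].
    by rewrite p1i //= andbT; apply: nb_adj; apply: domP.
  by rewrite p1J //; apply: path_subdivide (fan_path fp aP cJ); apply: domP.
- move=> _ c /mapP[a aP ->] /setU1P[->|cJ].
    rewrite p1i //=; apply/negP => /mapP[f fF /eqP].
    by rewrite (negbTE (nb_phi (domP _ aP) (domF _ fF))).
  rewrite p1J // last_subdivide; apply: contra (fan_exit fp aP cJ) => /mapP[f fF].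
  by move/phi_inj=> -> //; [exact: doml | exact: domF].
- move=> _ c v /mapP[a aP ->] /setU1P[->|cJ].
    rewrite p1i // inE => /eqP->; apply/negP => /mapP[f fF /eqP].
    by rewrite (negbTE (nb_phi (domP _ aP) (domA _ fF))).
  rewrite p1J // => vq; apply/negP => /mapP[f fA vE]; rewrite {}vE in vq.
  have := phi_mem_subdivide (domP _ aP) (domA _ fA) (fan_path fp aP cJ) vq.
  by move/(fan_avoid fp aP cJ); rewrite fA.
- move=> _ _ c d /mapP[a aP ->] /mapP[b bP ->] /setU1P[->|cJ] /setU1P[->|dJ]; rewrite ?eqxx // => cd.
  + by rewrite p1i // p1J //= last_subdivide; apply: nb_phi (doml _ _ bP dJ); apply: domP.
  + by rewrite p1i // p1J //= last_subdivide eq_sym; apply: nb_phi (doml _ _ aP cJ); apply: domP.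
  rewrite !p1J // !last_subdivide; apply: contra (fan_exit_neq fp aP bP cJ dJ cd) => /eqP.
  by move/phi_inj=> -> //; apply: doml.
- move=> _ _ c d v /mapP[a aP ->] /mapP[b bP ->] /setU1P[->|cJ] /setU1P[->|dJ]; rewrite ?eqxx // => cd sab.
  + rewrite p1i // p1J // in_cons => /orP[/eqP->|]; first by left.
    by rewrite inE => /eqP->; rewrite (negbTE (nb_sub _ _ _ (domP _ aP) bP dJ)).
  + rewrite p1i // p1J // => va; rewrite in_cons => /orP[/eqP->|]; first by right.
    by rewrite inE => /eqP vE; move: va; rewrite vE (negbTE (nb_sub _ _ _ (domP _ bP) aP cJ)).
  have sab' : sep -> a = b by move/sab/phi_inj; apply; apply: domP.
  have meet w : w \in a :: p a c -> w \in b :: p b d -> w = a \/ w = b.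
    exact: (fan_meet fp aP bP cJ dJ cd sab').
  have pa := fan_path fp aP cJ; have pb := fan_path fp bP dJ.
  have ia := domP _ aP; have ib := domP _ bP.
  rewrite !p1J // in_cons => /orP[/eqP->|va]; first by left.
  rewrite in_cons => /orP[/eqP->|vb]; first by right.
  case: (mem_subdivide pa va) => [[w wa vE]|[x [y [xa ya xy vx]]]].
    rewrite {v}vE in va vb *.
    have iw : i \notin w by apply: (domp a c); rewrite // inE wa orbT.
    have wb := phi_mem_subdivide ib iw pb vb.
    by case: (meet w); rewrite ?inE ?wa ?wb ?orbT // => ->; [left|right].
  have ix := domp _ _ _ aP cJ xa.
  case: (mem_subdivide pb vb) => [[w wb vE]|[x' [y' [xb yb xy' vx']]]].
    have iw : i \notin w by apply: (domp b d); rewrite // inE wb orbT.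
    by rewrite vE (negbTE (st_phi ix xy iw)) in vx.
  (* A common subdivision vertex comes from a single edge, so both ends of that edge lie on both
     paths and must be [a] and [b]. Each path then visits the start of the other, against
     [fan_cross]. *)
  have [xb' yb'] : x \in b :: p b d /\ y \in b :: p b d.
    by case: (st_inj ix (domp _ _ _ bP dJ xb) xy xy' vx vx') => -[-> ->].
  have := qadj_irr xy; have mx := meet _ xa xb'; have my := meet _ ya yb' => xny.
  have ab : a != b.
    by apply: contra xny => /eqP e; case: mx my => -> [] ->; rewrite ?e eqxx.
  have ns : ~~ sep by apply: contra ab => /sab' ->.
  have ba : b \in p a c.
    suff: b \in a :: p a c by rewrite inE eq_sym (negbTE ab).
    by case: mx my xny => e [] e'; move: xa ya; rewrite e e' ?eqxx.
  have ab1 : a \in p b d.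
    suff: a \in b :: p b d by rewrite inE (negbTE ab).
    by case: mx my xny => e [] e'; move: xb' yb'; rewrite e e' ?eqxx.
  by move: (fan_cross fp aP bP cJ dJ cd ns ab ba); rewrite ab1.
move=> _ _ c d /mapP[a aP ->] /mapP[b bP ->] /setU1P[->|cJ] /setU1P[->|dJ]; rewrite ?eqxx // => cd ns ab.
- by rewrite p1i // inE eq_sym (negbTE (nb_phi (domP _ aP) (domP _ bP))).
- by move=> _; rewrite p1i // inE eq_sym; apply: nb_phi; apply: domP.
have ab' : a != b by apply: contra ab => /eqP->.
rewrite !p1J // => /phi_mem_subdivide ba; apply/negP => /phi_mem_subdivide ab1.
have {}ba := ba (domP _ aP) (domP _ bP) (fan_path fp aP cJ).
have {}ab1 := ab1 (domP _ bP) (domP _ aP) (fan_path fp bP dJ).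
by move: (fan_cross fp aP bP cJ dJ cd ns ab' ba); rewrite ab1.
Qed.

End Lift.

(** * Inserting a constant or a copied coordinate *)

Definition setbit (i : I) (b : bool) (u : {set I}) : {set I} := [set x | if x == i then b else x \in u].

Lemma in_setbit i (b : bool) u : (i \in setbit i b u) = b.
Proof. by rewrite inE eqxx. Qed.

Lemma setbit_id i (b : bool) u : (i \in u) = b -> setbit i b u = u.
Proof. by move=> <-; apply/setP => x; rewrite inE; case: eqP => // ->. Qed.

Lemma setbitD1 i (b : bool) u : setbit i b (u :\ i) = setbit i b u.
Proof. by apply/setP => x; rewrite !inE; case: (x == i). Qed.

Lemma setbitK i (b : bool) u : i \notin u -> setbit i b u :\ i = u.
Proof.
by move=> iu; apply/setP => x; rewrite !inE; case: eqP => //= ->; rewrite (negbTE iu).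
Qed.

Lemma flip_setbit i (b : bool) c u : c != i -> setbit i b (flip c u) = flip c (setbit i b u).
Proof.
by move=> ci; apply/setP => x; rewrite !inE; case: (x =P i) => // ->; rewrite eq_sym (negbTE ci).
Qed.

Lemma setbit_neg i (b : bool) u : (i \in u) = ~~ b -> setbit i b u = flip i u.
Proof.
by move=> e; apply/setP => x; rewrite !inE; case: eqP => //= ->; rewrite e negbK.
Qed.

Lemma map_phi_D1 i (phi : {set I} -> {set I}) (s : seq {set I}) :
  {in s, forall u, phi (u :\ i) = u} -> map phi [seq u :\ i | u <- s] = s.
Proof. by move=> e; rewrite -map_comp; apply: map_id_in. Qed.

(** The smaller cube becomes the facet where bit [i] is [beta]; no edge is subdivided, and the
    opposite facet supplies the neighbours for the new colour. *)
Lemma fan_insert_const J i (beta : bool) P F A sep p : i \notin J ->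
  {in P ++ F ++ A, forall u, (i \in u) = beta} ->
  fan_system J [seq u :\ i | u <- P] [seq u :\ i | u <- F] [seq u :\ i | u <- A] sep p ->
  exists p1, fan_system (i |: J) P F A sep p1.
Proof.
move=> iJ eb fp; pose phi := setbit i beta.
have phiD s : {subset s <= P ++ F ++ A} -> map phi [seq u :\ i | u <- s] = s.
  by move=> ss; apply: map_phi_D1 => u /ss/eb e; rewrite /phi setbitD1 setbit_id.
have domD : {in map (fun u => u :\ i) P ++ map (fun u => u :\ i) F ++ map (fun u => u :\ i) A,
    forall u, i \notin u}.
  by rewrite -!map_cat => _ /mapP[u _ ->]; rewrite !inE eqxx.
have := fan_lift iJ (phi := phi) (st := fun _ _ => [::]) (nb := setbit i (~~ beta)) _ _ _ _ _ _ _ domD fp.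
rewrite !phiD; first (apply => //).
- by move=> u; apply: setbitK.
- move=> u v _ /exists_inP[c cJ /eqP->] /=; rewrite andbT /phi flip_setbit ?(memPn iJ) //.
  by rewrite qadj_flip // !inE cJ orbT.
- move=> u iu; have -> : setbit i (~~ beta) u = flip i (phi u).
    by rewrite -(@setbit_neg i (~~ beta)) ?in_setbit ?negbK //; apply/setP=> x; rewrite !inE; case: eqP.
  by rewrite qadj_flip // setU11.
- by move=> u w _ _; apply/eqP => /setP/(_ i); rewrite !in_setbit; case: (beta).
- by move=> u uA; rewrite !mem_cat uA !orbT.
- by move=> u uA; rewrite !mem_cat uA !orbT.
- by move=> u uA; rewrite !mem_cat uA.
Qed.

(* An edge in direction j becomes a path of length 2 through the vertex whose
   j-bit is 1 and whose i-bit is wrong; the vertices with j-bit 0 and wrong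
   i-bit are left over for the new colour. *)
Lemma fan_insert_copy J i j (beta : bool) P F A sep p : i \notin J -> j \in J ->
  {in P ++ F ++ A, forall u, (i \in u) = (j \in u) (+) beta} ->
  fan_system J [seq u :\ i | u <- P] [seq u :\ i | u <- F] [seq u :\ i | u <- A] sep p ->
  exists p1, fan_system (i |: J) P F A sep p1.
Proof.
move=> iJ jJ eb fp; pose phi u := setbit i ((j \in u) (+) beta) u.
have ji : j != i by apply: (memPn iJ).
have ij : i != j by rewrite eq_sym.
have phiD s : {subset s <= P ++ F ++ A} -> map phi [seq u :\ i | u <- s] = s.
  move=> ss; apply: map_phi_D1 => u /ss/eb e.
  by rewrite /phi setbitD1 setbit_id // !inE ji.
have domD : {in map (fun u => u :\ i) P ++ map (fun u => u :\ i) F ++ map (fun u => u :\ i) A,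
    forall u, i \notin u}.
  by rewrite -!map_cat => _ /mapP[u _ ->]; rewrite !inE eqxx.
pose mid u := setbit j true (setbit i beta u).
pose st u v := if (j \in u) == (j \in v) then [::] else [:: mid u].
pose nb u := setbit j false (setbit i (~~ beta) u).
have st_flip u v w : qadj J u v -> w \in st u v -> v = flip j u /\ w = mid u.
  case/exists_inP => c cJ /eqP->; rewrite /st; case: (eqVneq c j) => [->|cj].
    by rewrite in_flip; case: (j \in u) => //=; rewrite inE => /eqP.
  by rewrite in_flip_neq ?eqxx // eq_sym.
have := fan_lift iJ (phi := phi) (st := st) (nb := nb) _ _ _ _ _ _ _ domD fp.
rewrite !phiD; first (apply => //).
- by move=> u; apply: setbitK.
- move=> u v iu /exists_inP[c cJ /eqP->]; rewrite /st.
  have ci := memPn iJ c cJ; have cJ1 : c \in i |: J by rewrite !inE cJ orbT.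
  have iJ1 : i \in i |: J by apply: setU11.
  case: (eqVneq c j) => [{c cJ ci cJ1}-> |cj]; last first.
    rewrite in_flip_neq ?eqxx 1?eq_sym //= /phi in_flip_neq 1?eq_sym // flip_setbit //.
    by rewrite qadj_flip.
  have jJ1 : j \in i |: J by rewrite !inE jJ orbT.
  rewrite in_flip; case: (boolP (j \in u)) => ju /=; rewrite andbT; apply/andP; split.
  + suff -> : mid u = flip i (phi u) by apply: qadj_flip.
    apply/setP => x; rewrite !inE ju; case: (x =P j) => [->|_]; first by rewrite (negbTE ji) ju.
    by case: (x == i); case: (beta).
  + suff -> : phi (flip j u) = flip j (mid u) by apply: qadj_flip.
    apply/setP => x; rewrite !inE eqxx ju /=; case: (x =P j) => [->|_] //=.
    by rewrite (negbTE ji) ju.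
  + suff -> : mid u = flip j (phi u) by apply: qadj_flip.
    apply/setP => x; rewrite !inE (negbTE ju); case: (x =P j) => [->|_] //=.
    by rewrite (negbTE ji) (negbTE ju).
  suff -> : phi (flip j u) = flip i (mid u) by apply: qadj_flip.
  apply/setP => x; rewrite !inE eqxx (negbTE ju) /=; case: (x =P j) => [->|_] //=.
    by rewrite (negbTE ji) (negbTE ju).
  by case: (x == i); case: (beta).
- move=> u v w iu uv iw; apply/negP => /(st_flip _ _ _ uv)[_ /setP e].
  move: (e i) (e j); rewrite !inE !eqxx (negbTE ji) (negbTE ij).
  by case: (j \in w); case: (beta).
- move=> u v w iu uv iw; apply/negP => /(st_flip _ _ _ uv)[_ /setP e].
  by move: (e j); rewrite !in_setbit.
- move=> u v u' v' w iu iu' uv uv' /(st_flip _ _ _ uv)[-> ->] /(st_flip _ _ _ uv')[-> /setP e].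
  (* The subdivision vertex forgets only bit [j] of the ends of its edge, so it determines the edge
     up to orientation. *)
  have e' x : x != j -> (x \in u) = (x \in u').
    move=> xj; move: (e x); rewrite !inE (negbTE xj).
    by case: eqP => // -> _; rewrite (negbTE iu) (negbTE iu').
  have [ej|nej] := eqVneq (j \in u) (j \in u').
    have -> : u = u' by apply/setP => x; case: (eqVneq x j) => [->|/e'].
    by left.
  have -> : u = flip j u'.
    apply/setP => x; rewrite inE; case: (eqVneq x j) => [->|/e'] //=.
    by move: nej; case: (j \in u); case: (j \in u').
  by right; rewrite flipK.
- move=> u iu; case: (boolP (j \in u)) => ju.
    suff -> : nb u = flip j (phi u) by apply: qadj_flip; rewrite !inE jJ orbT.
    apply/setP => x; rewrite !inE ju; case: (x =P j) => [->|_] //=.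
    by rewrite (negbTE ji) ju.
  suff -> : nb u = flip i (phi u) by apply: qadj_flip; apply: setU11.
  apply/setP => x; rewrite !inE (negbTE ju); case: (x =P j) => [->|_] //=.
    by rewrite (negbTE ji) (negbTE ju).
  by case: (x == i).
- move=> u w iu iw; apply/eqP => /setP e.
  move: (e i) (e j); rewrite !inE !eqxx (negbTE ji) (negbTE ij).
  by case: (j \in w); case: (beta).
- by move=> u uA; rewrite !mem_cat uA !orbT.
- by move=> u uA; rewrite !mem_cat uA !orbT.
- by move=> u uA; rewrite !mem_cat uA.
Qed.

End Fans.

(** * Reduction to small cubes *)

Section Transport.
Variables (I : finType) (J : {set I}) (js : seq I) (t : {set I}).
Hypotheses (js_uniq : uniq js) (js_mem : js =i J).
Let k := size js.

(** The origin is sent to [t], and the bits of [v] say which coordinates of [t] are flipped. A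
    coordinate outside [js] has index [size js], where [nth] gives its default [false], so it keeps
    its value in [t]. *)
Definition decode (v : bits) : {set I} := [set x | (x \in t) (+) nth false v (index x js)].

Lemma size_bflip r v : r < size v -> size (bflip r v) = size v.
Proof. by move=> rv; rewrite size_set_nth; apply/maxn_idPr. Qed.

Lemma decode_bflip x v : size v = k -> x \in js ->
  decode (bflip (index x js) v) = flip x (decode v).
Proof.
move=> sv xj; apply/setP => y; rewrite !inE nth_set_nth /= addbCA.
have -> : (index y js == index x js) = (y == x).
  apply/eqP/eqP => [e|->//].
  have yj : y \in js by rewrite -index_mem e index_mem.
  by rewrite -(nth_index x yj) e nth_index.
by case: eqP => [->|//]; congr (_ (+) _).
Qed.

Lemma badjP v w : reflect (exists2 r, r < size v & w = bflip r v) (badj v w).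
Proof.
apply: (iffP hasP) => [[r]|[r rv ->]]; last by exists r; rewrite // mem_iota.
by rewrite mem_iota => rv /eqP->; exists r.
Qed.

Lemma decode_badj v w : size v = k -> badj v w ->
  size w = k /\ qadj J (decode v) (decode w).
Proof.
move=> sv /badjP[r rv ->]; rewrite size_bflip //; split=> //.
rewrite sv /k in rv; have [x xj ri] : exists2 x, x \in js & r = index x js.
  case: js rv js_uniq => // x0 s rv us; exists (nth x0 (x0 :: s) r); first exact: mem_nth.
  by rewrite index_uniq.
by rewrite ri decode_bflip // qadj_flip // -js_mem.
Qed.

Lemma decode_inj v w : size v = k -> size w = k -> decode v = decode w -> v = w.
Proof.
move=> sv sw /setP e; apply: (@eq_from_nth _ false); rewrite ?sw // => r; rewrite sv /k => rk.
have x0 : I by case: js rk => [//|x0 _ _]; exact: x0.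
by have := e (nth x0 js r); rewrite !inE index_uniq // => /addbI.
Qed.

Lemma mem_decode v s : size v = k -> all (fun w => size w == k) s ->
  (decode v \in map decode s) = (v \in s).
Proof.
move=> sv ss; apply/mapP/idP => [[w ws e]|vs]; last by exists v.
by rewrite (decode_inj sv _ e) //; apply/eqP/(allP ss).
Qed.

Lemma decode_path v q : size v = k -> path badj v q ->
  all (fun w => size w == k) (v :: q) /\ path (qadj J) (decode v) (map decode q).
Proof.
elim: q v => [|w q IH] v sv /=; first by rewrite sv eqxx.
case/andP=> vw pq; have [sw aw] := decode_badj sv vw; have [sq pq'] := IH w sw pq.
by rewrite sv eqxx aw; split.
Qed.

Lemma compatP sep a c q b d r : compat sep (a, c, q) (b, d, r) -> (c == d) = false ->
  last a q != last b r /\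
  (sep && (a != b) = false ->
    {in a :: q, forall v, v \in b :: r -> v = a \/ v = b} /\ (a != b -> ~~ ((b \in q) && (a \in r)))).
Proof.
rewrite /compat => + cd; rewrite cd; case: eqP => // _ cmp; split=> // ns; move: cmp; rewrite ns.
case: ifP => // /allP meet cross; split=> [v va vb|ab]; last by move: cross; rewrite (negbTE ab).
by move: (meet v va); rewrite vb => /orP[]/eqP; [left|right].
Qed.

Lemma verify_fan P F A sep sol :
  all (fun w => size w == k) P -> all (fun w => size w == k) F -> all (fun w => size w == k) A ->
  verify k P F A sep sol ->
  exists p, fan_system J (map decode P) (map decode F) (map decode A) sep p.
Proof.
move=> sP sF sA /and3P[/allP hasL /allP okL /allP cmp].
(* A colour [i] is numbered by its index in [js]. The test [e.1.1 \in P] fixes the length of the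
   start, which makes [decode] injective there; the empty default never occurs, since [verify] found
   a leg for every pair. *)
pose p a i := if [seq e <- sol | [&& e.1.1 \in P, decode e.1.1 == a & e.1.2 == index i js]] is e :: _
              then map decode e.2 else [::].
have szP a : a \in P -> size a = k by move/(allP sP)/eqP.
have spec a i : a \in map decode P -> i \in J -> exists b q,
    [/\ b \in P, a = decode b, (b, index i js, q) \in sol & p a i = map decode q].
  move=> /mapP[b bP ->]; rewrite -js_mem -index_mem => iJ.
  have /hasP[e es /andP[/eqP e1 /eqP e2]] : has (fun e : leg => (e.1.1 == b) && (e.1.2 == index i js)) sol.
    by apply: (allP (hasL _ bP)); rewrite mem_iota.
  rewrite /p; set fl := filter _ _; have : e \in fl by rewrite mem_filter e1 e2 bP !eqxx es.
  case Efl: fl => [//|f l] _; have : f \in fl by rewrite Efl mem_head.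
  rewrite mem_filter; case: f {Efl} => [[b' c] q] /= /andP[/and3P[b'P /eqP db /eqP ->] fs].
  by exists b, q; split=> //; rewrite -(decode_inj (szP _ b'P) (szP _ bP) db).
have legP b c q : b \in P -> (b, c, q) \in sol ->
    [/\ all (fun w => size w == k) (b :: q), path (qadj J) (decode b) (map decode q),
        last b q \notin F & all (fun v => v \notin A) q].
  move=> bP /okL /and3P[pq lq aq]; have [sq pq'] := decode_path (szP _ bP) pq.
  by split.
have szL b c q v : b \in P -> (b, c, q) \in sol -> v \in b :: q -> size v = k.
  by move=> bP /(legP _ _ _ bP)[/allP sq _ _ _] /sq /eqP.
have idx i j : i \in J -> i != j -> (index i js == index j js) = false.
  move=> iJ ij; apply: contraNF ij => /eqP e; apply/eqP.
  have iS : i \in js by rewrite js_mem.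
  have jS : j \in js by rewrite -index_mem -e index_mem.
  by rewrite -(nth_index i iS) e nth_index.
exists p; split.
- move=> a i aP iJ; have [b [q [bP -> bs ->]]] := spec a i aP iJ.
  by case: (legP _ _ _ bP bs).
- move=> a i aP iJ; have [b [q [bP -> bs ->]]] := spec a i aP iJ.
  rewrite last_map mem_decode //; first by case: (legP _ _ _ bP bs).
  exact: szL bP bs (mem_last _ _).
- move=> a i v aP iJ; have [b [q [bP _ bs ->]]] := spec a i aP iJ => /mapP[w wq ->].
  rewrite mem_decode //; first by case: (legP _ _ _ bP bs) => _ _ _ /allP; apply.
  by apply: szL bP bs _; rewrite inE wq orbT.
- move=> a a' i j aP a'P iJ jJ ij.
  have [b [q [bP -> bs ->]]] := spec a i aP iJ.
  have [b' [q' [b'P -> b's ->]]] := spec a' j a'P jJ.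
  have [ne _] := compatP (allP (cmp _ bs) _ b's) (idx _ _ iJ ij).
  rewrite !last_map; apply: contra ne => /eqP/decode_inj -> //.
    exact: szL bP bs (mem_last _ _).
  exact: szL b'P b's (mem_last _ _).
- move=> a a' i j v aP a'P iJ jJ ij sab.
  have [b [q [bP aE bs ->]]] := spec a i aP iJ.
  have [b' [q' [b'P a'E b's ->]]] := spec a' j a'P jJ.
  rewrite {}aE {}a'E in sab *; rewrite -!map_cons => /mapP[w wq ->].
  have sw := szL _ _ _ _ bP bs wq.
  rewrite mem_decode //; last by case: (legP _ _ _ b'P b's).
  have [_ cm] := compatP (allP (cmp _ bs) _ b's) (idx _ _ iJ ij).
  have ns : sep && (b != b') = false.
    by apply/negbTE; move: sab; case: (sep) => //= /(_ isT)/decode_inj -> //; rewrite ?eqxx ?szP.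
  by have [meet _] := cm ns => /(meet w wq) [] ->; [left|right].
move=> a a' i j aP a'P iJ jJ ij ns aa'.
have [b [q [bP aE bs ->]]] := spec a i aP iJ.
have [b' [q' [b'P a'E b's ->]]] := spec a' j a'P jJ.
rewrite {}aE {}a'E in aa' *; have bb' : b != b' by apply: contra aa' => /eqP->.
have [_] := compatP (allP (cmp _ bs) _ b's) (idx _ _ iJ ij).
rewrite (negbTE ns) => /(_ erefl)[_ /(_ bb')]; rewrite !mem_decode ?szP //.
- by rewrite negb_and => /orP[/negP|].
- by case: (legP _ _ _ b'P b's) => /andP[].
- by case: (legP _ _ _ bP bs) => /andP[].
Qed.

End Transport.

(** * Induction on the dimension by types of coordinates *)

Section Marks.
Variable I : finType.
Implicit Types (J : {set I}) (M : seq {set I}).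

(* The type of coordinate j relative to the marks M, as in [marks_of]. *)
Definition code M (j : I) : nat :=
  let b r := (j \in nth set0 M r) (+) (j \in nth set0 M 0) in b 1 + (b 2).*2 + (b 3).*2.*2.

Definition marks_fan J pn fn av sep M := exists p,
  fan_system J (take pn M) (drop fn M) (if av then drop fn M else [::]) sep p.

(** With mark 0 as the origin of [decode], the types determine the marks: on [J] by definition, and
    outside [J] because all marks agree there. So one search per list of types suffices. *)
Lemma marks_fan_base J pn fn (av sep : bool) (m0 m1 m2 m3 : {set I}) (js : seq I) : uniq js -> js =i J ->
  (forall x, x \notin J -> [/\ (x \in m1) = (x \in m0), (x \in m2) = (x \in m0) & (x \in m3) = (x \in m0)]) ->
  solvable pn fn av sep [seq code [:: m0; m1; m2; m3] j | j <- js] ->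
  marks_fan J pn fn av sep [:: m0; m1; m2; m3].
Proof.
set M := [:: m0; m1; m2; m3] => ujs mjs out; rewrite /solvable size_map.
set s := map _ js; case: search => // sol vsol.
have sz : all (fun w => size w == size js) (marks_of s).
  by rewrite /= size_nseq !size_map eqxx.
have sub s' : subseq s' (marks_of s) -> all (fun w => size w == size js) s'.
  by move=> /mem_subseq ss; apply/allP => w /ss; apply: (allP sz).
have dec (f : nat -> bool) (m : {set I}) : (forall x, x \in J -> f (code M x) = (x \in m) (+) (x \in m0)) ->
    (forall x, x \notin J -> (x \in m) = (x \in m0)) -> decode js m0 (map f s) = m.
  move=> fJ fN; apply/setP => x; rewrite inE; case: (boolP (x \in J)) => xJ.
    by rewrite -map_comp (nth_map x) ?index_mem ?mjs // nth_index ?mjs //= fJ // addbCA addbb addbF.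
  by rewrite nth_default ?fN ?addbF // !size_map memNindex // mjs.
have ME : map (decode js m0) (marks_of s) = M.
  rewrite /marks_of /M; congr [:: _; _; _; _].
  - by apply/setP => x; rewrite inE nth_nseq if_same addbF.
  - apply: dec => x xJ; last by case: (out x xJ).
    by rewrite /code /= !oddD !odd_double !addbF oddb.
  - apply: dec => x xJ; last by case: (out x xJ).
    by rewrite /code /=; do 3 case: (_ (+) _).
  apply: dec => x xJ; last by case: (out x xJ).
  by rewrite /code /=; do 3 case: (_ (+) _).
have [] := @verify_fan I J js m0 ujs mjs _ _ _ _ _ _ _ _ vsol.
- by apply: sub; apply: take_subseq.
- by apply: sub; apply: drop_subseq.
- by case: (av) => //; apply: sub; apply: drop_subseq.
move=> p; rewrite map_take map_drop ME => fp; exists p.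
by case: (av) fp => //; rewrite map_drop ME.
Qed.

Lemma mem_subs (s l : seq nat) : subseq s l -> s \in subs l.
Proof.
elim: l s => [|x l IH] [|y s] //=; rewrite mem_cat.
  by move=> _; rewrite [_ \in subs l]IH ?orbT ?sub0seq.
case: eqP => [->|_] ss; last by rewrite IH ?orbT.
by rewrite map_f // IH.
Qed.

Lemma mem_codes3 s : sorted leq s -> all (fun c => c < 8) s -> size s = 3 -> s \in codes3.
Proof.
case: s => [|a [|b [|c []]]] //= /and3P[ab bc _] /and4P[a8 b8 c8 _] _.
apply/flattenP; exists [seq [:: a; b; c] | b <- iota a (8 - a), c <- iota b (8 - b)].
  by apply/mapP; exists a; rewrite ?mem_iota.
by apply/allpairsPdep; exists b, c; rewrite !mem_iota ab bc !subnKC // ltnW.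
Qed.

Lemma mem_codesI s : sorted leq s -> all (fun c => c < 8) s -> uniq s -> 0 \notin s ->
  3 < size s -> s \in codesI.
Proof.
move=> so s8 us s0 s3; rewrite mem_filter s3 andTb; apply: mem_subs.
have -> : s = [seq c <- iota 1 7 | c \in s].
  apply: (irr_sorted_eq ltn_trans ltnn).
  - by rewrite ltn_sorted_uniq_leq us.
  - by apply: sorted_filter; [exact: ltn_trans | exact: iota_ltn_sorted].
  move=> c; rewrite mem_filter mem_iota; case: (boolP (c \in s)) => //= cs.
  by rewrite (allP s8 _ cs) lt0n andbT; apply/esym; apply: contraNneq s0 => <-.
exact: filter_subseq.
Qed.

Lemma code_lt8 M j : code M j < 8.
Proof. by rewrite /code; do 3 case: (_ (+) _). Qed.

(** A coordinate of type 0 is removed by [fan_insert_const], one whose type is repeated by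
    [fan_insert_copy], until a listed case is reached. The predicate [ok] restricts the
    configurations and must pass to the smaller list in both reductions. *)
Lemma marks_fan_ind pn fn (av sep : bool) (ok : seq nat -> bool) :
  all (solvable pn fn av sep) [seq s <- codes3 ++ codesI | ok s] ->
  (forall s s', perm_eq s s' -> ok s -> ok s') ->
  (forall s, 2 < size s -> ok (0 :: s) -> ok s) ->
  (forall s c, 2 < size s -> 0 \notin s -> c \in s -> ok (c :: s) -> ok s) ->
  forall J (m0 m1 m2 m3 : {set I}), let M := [:: m0; m1; m2; m3] in 2 < #|J| ->
  (forall x, x \notin J -> [/\ (x \in m1) = (x \in m0), (x \in m2) = (x \in m0) & (x \in m3) = (x \in m0)]) ->
  ok [seq code M j | j <- enum J] -> marks_fan J pn fn av sep M.
Proof.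
move=> /allP hs okP okZ okC J; move: {2}#|J| (erefl #|J|) => k.
elim: k J => [|k IH] J Jk m0 m1 m2 m3 M J2 out okJ; first by rewrite Jk in J2.
(* Sorting the coordinates by type gives the normal form in which the searched lists are
   enumerated. *)
pose js := sort (relpre (code M) leq) (enum J); pose s := [seq code M j | j <- js].
have sE : s = sort leq [seq code M j | j <- enum J] by rewrite /s /js -sort_map.
have pj : perm_eq js (enum J) by rewrite perm_sort.
have oks : ok s by apply: okP okJ; rewrite sE perm_sym perm_sort.
have so : sorted leq s by rewrite sE; apply: sort_sorted; apply: leq_total.
have s8 : all (fun c => c < 8) s by apply/allP => _ /mapP[j _ ->]; apply: code_lt8.
have ujs : uniq js by rewrite (perm_uniq pj) enum_uniq.
have mjs : js =i J by move=> x; rewrite (perm_mem pj) mem_enum.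
have szs : size s = #|J| by rewrite size_map (perm_size pj) -cardE.
have base : s \in codes3 ++ codesI -> marks_fan J pn fn av sep M.
  by move=> sc; apply: marks_fan_base ujs mjs out _; apply: hs; rewrite mem_filter oks.
have [s3|s3] := eqVneq (size s) 3.
  by apply: base; rewrite mem_cat mem_codes3.
have {}s3 : 3 < size s by rewrite ltn_neqAle eq_sym s3 szs.
have reduce i : i \in J -> (ok [seq code M j | j <- enum (J :\ i)]) ->
    marks_fan (J :\ i) pn fn av sep [seq m :\ i | m <- M].
  move=> iJ ok'; apply: IH.
  - by apply/eqP; rewrite -eqSS -Jk (cardsD1 i J) iJ.
  - by move: s3; rewrite szs (cardsD1 i J) iJ.
  - move=> x; rewrite !inE; case: (x =P i) => //= _; exact: out.
  have -> // : [seq code [seq m :\ i | m <- M] j | j <- enum (J :\ i)] = [seq code M j | j <- enum (J :\ i)].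
  apply/eq_in_map => j; rewrite mem_enum !inE => /andP[ji _].
  by rewrite /code /= !inE ji.
have split_okM i : i \in J -> perm_eq s (code M i :: [seq code M j | j <- enum (J :\ i)]).
  move=> iJ; rewrite -map_cons; apply: perm_map; apply: (perm_trans pj).
  apply: uniq_perm; rewrite ?enum_uniq //= ?enum_uniq ?mem_enum ?inE ?eqxx //.
  by move=> x; rewrite inE !mem_enum !inE; case: eqP => // ->.
have szr i : i \in J -> 2 < size [seq code M j | j <- enum (J :\ i)].
  by move=> iJ; rewrite size_map -cardE -ltnS; move: s3; rewrite szs (cardsD1 i J) iJ.
have inM P F A (Q : {set I} -> Prop) : (forall m, m \in M -> Q m) ->
    {subset P <= M} -> {subset F <= M} -> {subset A <= M} -> {in P ++ F ++ A, forall u, Q u}.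
  by move=> QM sP sF sA u; rewrite !mem_cat => /or3P[/sP|/sF|/sA] /QM.
have subA : {subset (if av then drop fn M else [::]) <= M}.
  by case: (av) => // u /mem_drop.
have mapA i : [seq m :\ i | m <- if av then drop fn M else [::]] =
    if av then drop fn [seq m :\ i | m <- M] else [::].
  by case: (av); rewrite // map_drop.
have [/mapP[i ijs i0]|s0] := boolP (0 \in s).
  have iJ : i \in J by rewrite -mjs.
  have ok' : ok [seq code M j | j <- enum (J :\ i)].
    by apply: okZ (szr i iJ) _; rewrite i0; apply: okP oks; apply: split_okM.
  have [p fp] := reduce i iJ ok'.
  rewrite /marks_fan -[J in fan_system J](setD1K iJ).
  apply: (@fan_insert_const _ (J :\ i) i (i \in m0) _ _ _ _ p).
  - by rewrite !inE eqxx.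
  - apply: inM => [m|u /mem_take|u /mem_drop|] //.
    move: i0; rewrite /code /= !inE => i0 /or4P[] /eqP-> //; move: i0;
    by case: (i \in m0); case: (i \in m1); case: (i \in m2); case: (i \in m3).
  by rewrite map_take map_drop mapA.
have [us|nus] := boolP (uniq s).
  by apply: base; rewrite mem_cat mem_codesI ?orbT.
have [i [j [iJ jJ ij cij]]] : exists i j, [/\ i \in J, j \in J, j != i & code M i = code M j].
  have [/existsP[i /existsP[j /and4P[iJ jJ ij /eqP e]]]|/existsPn none] :=
    boolP [exists i, exists j, [&& i \in J, j \in J, j != i & code M i == code M j]].
    by exists i, j.
  case/negP: nus; rewrite map_inj_in_uniq // => i j ij jj e.
  apply/eqP; have /existsPn/(_ j) := none i; rewrite e eqxx -!mjs ij jj andbT /= negbK.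
  by rewrite eq_sym.
have ok' : ok [seq code M j | j <- enum (J :\ i)].
  apply: (okC _ (code M i)) (szr i iJ) _ _ _.
  - by apply: contra s0 => s0; rewrite (perm_mem (split_okM i iJ)) inE s0 orbT.
  - by rewrite cij map_f // mem_enum !inE ij.
  by apply: okP oks; apply: split_okM.
have [p fp] := reduce i iJ ok'.
rewrite /marks_fan -[J in fan_system J](setD1K iJ).
(* Equal types make the bits [i] and [j] agree on all marks up to one fixed complement, which is
   read off at [m0]. *)
apply: (@fan_insert_copy _ (J :\ i) i j ((i \in m0) (+) (j \in m0)) _ _ _ _ p).
- by rewrite !inE eqxx.
- by rewrite !inE ij.
- apply: inM => [m|u /mem_take|u /mem_drop|] //.
  move: cij; rewrite /code /= => cij.
  have {cij} [e1 e2 e3] : [/\ (i \in m1) (+) (i \in m0) = (j \in m1) (+) (j \in m0),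
      (i \in m2) (+) (i \in m0) = (j \in m2) (+) (j \in m0) &
      (i \in m3) (+) (i \in m0) = (j \in m3) (+) (j \in m0)].
    by move: cij; do 6 case: (_ (+) _).
  have aux (x y x0 y0 : bool) : x (+) x0 = y (+) y0 -> x = y (+) (x0 (+) y0) by case: x y x0 y0 => [] [] [] [].
  rewrite !inE => /or4P[] /eqP->; [|exact: aux..].
  by rewrite addbCA addbb addbF.
by rewrite map_take map_drop mapA.
Qed.

End Marks.

(** * Routings and hubs *)

Lemma connect_homo (T T' : finType) (e : rel T) (e' : rel T') (f : T -> T') :
  {homo f : x y / e x y >-> e' x y} -> {homo f : x y / connect e x y >-> connect e' x y}.
Proof.
move=> ef x y /connectP[q]; elim: q x => [|z q IH] x /=; first by move=> _ ->; apply: connect0.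
by move=> /andP[exz pq] yE; apply: connect_trans (connect1 (ef _ _ exz)) (IH z pq yE).
Qed.

Section Routing.
Variables (T : finType) (adj : rel T) (C : eqType).

(* h colours the hubs, and p s i leads from the terminal s to a hub of colour i. *)
Record routing (S : seq T) (h : T -> option C) (p : T -> C -> seq T) : Prop := Routing {
  route_path : forall s i, s \in S -> path adj s (p s i);
  route_end : forall s i, s \in S -> h (last s (p s i)) = Some i;
  route_hub : forall s i j v, s \in S -> v \in s :: p s i -> h v = Some j -> i = j;
  route_meet : forall s t i j v, s \in S -> t \in S -> i != j ->
    v \in s :: p s i -> v \in t :: p t j -> v = s \/ v = t;
  route_cross : forall s t i j, s \in S -> t \in S -> i != j -> s != t ->
    t \in p s i -> s \notin p t j;
  hub_connect : forall i u v, h u = Some i -> h v = Some i ->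
    connect (fun a b => [&& adj a b, h a == Some i & h b == Some i]) u v }.

Definition routable S := exists h p, routing S h p.

Lemma routable_eq_mem S S' : S =i S' -> routable S -> routable S'.
Proof.
move=> SS' [h [p [rp re rh rm rc hc]]]; exists h, p; split=> //.
- by move=> s i; rewrite -SS'; apply: rp.
- by move=> s i; rewrite -SS'; apply: re.
- by move=> s i j v; rewrite -SS'; apply: rh.
- by move=> s t i j v; rewrite -!SS'; apply: rm.
- by move=> s t i j; rewrite -!SS'; apply: rc.
Qed.

End Routing.

Lemma routable_map (T T' : finType) (adj : rel T) (adj' : rel T') (C : eqType)
    (f : T -> T') (g : T' -> T) S :
  cancel f g -> cancel g f -> {homo f : x y / adj x y >-> adj' x y} ->
  routable adj C S -> routable adj' C (map f S).
Proof.
move=> fK gK fadj [h [p [rp re rh rm rc hc]]].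
have fI := can_inj fK.
exists (h \o g), (fun s i => map f (p (g s) i)); split.
- by move=> _ i /mapP[s sS ->]; rewrite fK; apply: homo_path (rp s i sS).
- by move=> _ i /mapP[s sS ->]; rewrite fK last_map /= fK re.
- move=> _ i j v' /mapP[s sS ->]; rewrite fK -map_cons => /mapP[v vq ->] /=; rewrite fK.
  exact: rh sS vq.
- move=> _ _ i j v' /mapP[s sS ->] /mapP[t tS ->] ij; rewrite !fK -!map_cons => /mapP[v vq ->].
  by rewrite mem_map // => vq'; case: (rm s t i j v sS tS ij vq vq') => ->; [left|right].
- move=> _ _ i j /mapP[s sS ->] /mapP[t tS ->] ij; rewrite !fK !mem_map // (inj_eq fI).
  exact: rc.
move=> i u v hu hv; rewrite -(gK u) -(gK v).
apply: connect_homo (hc i _ _ hu hv) => a b /and3P[ab ha hb] /=.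
by rewrite !fK fadj ?ha.
Qed.

(** The edges of colour [i] are those inside its hub and those with both ends on one route of colour
    [i]. Two colours then share no vertex except terminals. *)
Lemma routable_has_S_trees (T : finType) (adj : rel T) m (S : seq T) :
  symmetric adj -> irreflexive adj -> S != [::] -> routable adj 'I_m S ->
  has_S_trees adj [set s in S] m.
Proof.
move=> sym irr S0 [h [p [rp re rh rm rc hc]]].
pose on_route i u v s := (u \in s :: p s i) && (v \in s :: p s i).
pose R i u v := adj u v && ((h u == Some i) && (h v == Some i) || has (on_route i u v) S).
have RP i u v : R i u v -> [/\ u != v, adj u v &
    (h u = Some i /\ h v = Some i) \/ exists2 s, s \in S & (u \in s :: p s i) /\ (v \in s :: p s i)].
  move=> /andP[auv H]; split=> //; first by apply: contraTneq auv => ->; rewrite irr.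
  by case/orP: H => [/andP[/eqP hu /eqP hv]|/hasP[s sS /andP[us vs]]]; [left|right; exists s].
apply: (has_S_trees_of_rels (R := R)).
- by case: S S0 {rp re rh rm rc on_route R RP} => // s S _; apply/set0Pn; exists s; rewrite !inE eqxx.
- move=> i u v; rewrite /R sym; congr (_ && (_ || _)); first by rewrite andbC.
  by apply: eq_has => s; apply: andbC.
- by move=> i u v /andP[].
- move=> i j u v w ij /RP[_ _ Hi] /RP[_ _ Hj]; rewrite inE.
  case: Hi Hj => [[hu _]|[s sS [us _]]] [[hu' _]|[t tS [ut _]]].
  + by move: ij; move: hu'; rewrite hu => -[->]; rewrite eqxx.
  + by move: ij; rewrite (rh t j i u tS ut hu) eqxx.
  + by move: ij; rewrite (rh s i j u sS us hu') eqxx.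
  by case: (rm s t i j u sS tS ij us ut) => ->.
- move=> i j u v ij /RP[uv _ Hi]; apply/negP => /RP[_ _ Hj].
  case: Hi Hj => [[hu _]|[s sS [us vs]]] [[hu' _]|[t tS [ut vt]]].
  + by move: ij; move: hu'; rewrite hu => -[->]; rewrite eqxx.
  + by move: ij; rewrite (rh t j i u tS ut hu) eqxx.
  + by move: ij; rewrite (rh s i j u sS us hu') eqxx.
  (* An edge in two colours would join two terminals, each route passing through the start of the
     other, which [route_cross] excludes. *)
  have mu := rm s t i j u sS tS ij us ut; have mv := rm s t i j v sS tS ij vs vt.
  have st : s != t by apply: contra uv => /eqP e; case: mu mv => -> [] ->; rewrite ?e.
  have ts : t \in p s i.
    suff: t \in s :: p s i by rewrite inE eq_sym (negbTE st).
    by case: mu mv uv => e [] e'; move: us vs; rewrite e e' ?eqxx.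
  have ss : s \in p t j.
    suff: s \in t :: p t j by rewrite inE (negbTE st).
    by case: mu mv uv => e [] e'; move: ut vt; rewrite e e' ?eqxx.
  by move: (rc s t i j sS tS ij st ts); rewrite ss.
move=> i s t; rewrite !inE => sS tS.
have Rsym : symmetric (R i).
  move=> u v; rewrite /R sym; congr (_ && (_ || _)); first by rewrite andbC.
  by apply: eq_has => ?; apply: andbC.
have to_hub u : u \in S -> connect (R i) u (last u (p u i)).
  move=> uS; apply/connectP; exists (p u i) => //.
  apply: (sub_in_path (P := mem (u :: p u i))) (rp u i uS); last by apply/allP.
  move=> a b aq bq ab; rewrite /R ab; apply/orP; right; apply/hasP; exists u => //.
  exact/andP.
apply: connect_trans (to_hub s sS) _; rewrite (sym_connect_sym Rsym).
apply: connect_trans (to_hub t tS) _.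
apply: connect_sub (hc i _ _ (re t i tS) (re s i sS)) => a b /and3P[ab ha hb].
by apply: connect1; rewrite /R ab ha hb.
Qed.

(** * The dual cube in product coordinates *)

Section DualCube.
Variable I : finType.
Implicit Types (x y u w : {set I}) (i j : I).

Definition vert := (bool * {set I} * {set I})%type.

(* In (b, x, y) the bit b is u_{2n-1}, x collects the bits 1..n-1 and y the bits
   n..2n-2: a cluster of class false is given by y, one of class true by x. *)
Definition dadj : rel vert := fun s t =>
  let: (b, x, y) := s in let: (c, x', y') := t in
  if b == c then if b then (x == x') && qadj setT y y' else (y == y') && qadj setT x x'
  else (x == x') && (y == y').

Lemma dadj_sym : symmetric dadj.
Proof.
by move=> [[[] x] y] [[[] x'] y'] /=; rewrite ?(eq_sym x') ?(eq_sym y') // qadj_sym.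
Qed.

Definition swap (s : vert) : vert := let: (b, x, y) := s in (~~ b, y, x).

Lemma swapK : involutive swap.
Proof. by move=> [[[] x] y]. Qed.

Lemma swap_adj : {homo swap : s t / dadj s t}.
Proof. by move=> [[[] x] y] [[[] x'] y'] //=; rewrite andbC. Qed.

Lemma routable_swap S : routable dadj I (map swap S) -> routable dadj I S.
Proof.
move/(routable_map swapK swapK swap_adj); rewrite -map_comp.
by rewrite (eq_map (g := id)) ?map_id //; apply: swapK.
Qed.

Lemma qadj_connect x y : connect (qadj setT) x y.
Proof.
have c0 u : connect (qadj setT) set0 u.
  move: {2}#|u| (erefl #|u|) => n; elim: n u => [|n IH] u un.
    by rewrite (cards0_eq un) connect0.
  have /set0Pn[i iu] : u != set0 by rewrite -card_gt0 un.
  have -> : u = flip i (u :\ i).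
    by apply/setP => x0; rewrite !inE; case: eqP => // ->; rewrite iu.
  apply: connect_trans (connect1 (qadj_flip _ (in_setT i))); apply: IH.
  by move: un; rewrite (cardsD1 i) iu => -[].
apply: connect_trans (c0 y); rewrite (sym_connect_sym (@qadj_sym _ _)); exact: c0.
Qed.

(** The point where a path leaves a cluster of one class names the cluster of the other class that
    it enters. So [c0] lives on the x-parts and colours the clusters of class true, [c1] those of
    class false. *)
Definition hub (c0 c1 : {set I} -> option I) (s : vert) : option I :=
  if s.1.1 then c0 s.1.2 else c1 s.2.

(** Fix one cluster of colour [i] in each class. Clusters are connected, and clusters of different
    classes are joined by an edge, so every vertex of the hub reaches the end [(true, a, b)] of the
    edge between the two fixed clusters. *)
Lemma hub_connected c0 c1 : (forall i, exists x, c0 x = Some i) -> (forall i, exists y, c1 y = Some i) ->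
  forall i (u v : vert), hub c0 c1 u = Some i -> hub c0 c1 v = Some i ->
  connect (fun a b => [&& dadj a b, hub c0 c1 a == Some i & hub c0 c1 b == Some i]) u v.
Proof.
move=> s0 s1 i u v hu hv; have [a ca] := s0 i; have [b cb] := s1 i.
set e := (X in connect X).
have horiz x y y' : c0 x = Some i -> connect e (true, x, y) (true, x, y').
  move=> cx; apply: (connect_homo (f := fun y => (true, x, y))) (qadj_connect y y') => z z' zz'.
  by rewrite /e /= eqxx zz' /hub /= cx eqxx.
have horiz' x x' y : c1 y = Some i -> connect e (false, x, y) (false, x', y).
  move=> cy; apply: (connect_homo (f := fun x => (false, x, y))) (qadj_connect x x') => z z' zz'.
  by rewrite /e /= eqxx zz' /hub /= cy eqxx.
have cross0 x y : c0 x = Some i -> c1 y = Some i -> connect e (false, x, y) (true, x, y).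
  by move=> cx cy; apply: connect1; rewrite /e /= !eqxx /hub /= cx cy eqxx.
have cross1 x y : c0 x = Some i -> c1 y = Some i -> connect e (true, x, y) (false, x, y).
  by move=> cx cy; apply: connect1; rewrite /e /= !eqxx /hub /= cx cy eqxx.
have esym : symmetric e.
  by move=> s t; rewrite /e dadj_sym [in RHS]andbCA andbA andbC.
have to_root (w : vert) : hub c0 c1 w = Some i -> connect e w (true, a, b).
  case: w => [[[] x] y]; rewrite /hub /= => cw.
    apply: connect_trans (horiz x y b cw) _.
    apply: connect_trans (cross1 x b cw cb) _.
    by apply: connect_trans (horiz' x a b cb) (cross0 a b ca cb).
  apply: connect_trans (horiz' x a y cw) _.
  by apply: connect_trans (cross0 a y ca cw) (horiz a y b ca).
apply: connect_trans (to_root u hu) _; rewrite (sym_connect_sym esym); exact: to_root.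
Qed.

(** Only clusters entered by some path are coloured; [fan_exit_neq] makes the choice of [i]
    unambiguous. *)
Definition exit_color (P : seq {set I}) (p : {set I} -> I -> seq {set I}) (x : {set I}) : option I :=
  [pick i | has (fun a => last a (p a i) == x) P].

Section ExitColor.
Variables (P F A : seq {set I}) (sep : bool) (p : {set I} -> I -> seq {set I}).
Hypothesis fp : fan_system [set: I] P F A sep p.

Lemma exit_color_last a i : a \in P -> exit_color P p (last a (p a i)) = Some i.
Proof.
move=> aP; rewrite /exit_color; case: pickP => [j /hasP[b bP /eqP e]|/(_ i)/hasPn/(_ a aP)].
  have [->//|ij] := eqVneq j i.
  by have := fan_exit_neq fp bP aP (in_setT j) (in_setT i) ij; rewrite e eqxx.
by rewrite eqxx.
Qed.

Lemma exit_color_forbidden x : x \in F -> exit_color P p x = None.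
Proof.
move=> xF; rewrite /exit_color; case: pickP => // i /hasP[a aP /eqP e].
by have := fan_exit fp aP (in_setT i); rewrite e xF.
Qed.

Lemma exit_color_onto : P != [::] -> forall i, exists x, exit_color P p x = Some i.
Proof.
move: exit_color_last; case: P => // a s el _ i; exists (last a (p a i)).
by apply: el; apply: mem_head.
Qed.

End ExitColor.

Section Combine.
Variables (S : seq vert) (P0 F0 A0 P1 F1 A1 : seq {set I}) (sep0 sep1 : bool).
Variables (p0 p1 : {set I} -> I -> seq {set I}).
Hypotheses (fp0 : fan_system setT P0 F0 A0 sep0 p0) (fp1 : fan_system setT P1 F1 A1 sep1 p1).
Hypotheses (P0n : P0 != [::]) (P1n : P1 != [::]).
Hypothesis S0 : forall x y, (false, x, y) \in S -> x \in P0 /\ y \in F1.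
Hypothesis S1 : forall x y, (true, x, y) \in S -> y \in P1 /\ x \in F0.
Hypothesis sepS0 : forall x x' y, sep0 -> (false, x, y) \in S -> (false, x', y) \in S -> x = x'.
Hypothesis sepS1 : forall x y y', sep1 -> (true, x, y) \in S -> (true, x, y') \in S -> y = y'.

(** One fan system on x-parts serves all terminals of class false, one on y-parts those of class
    true. Each forbids the clusters holding terminals of the other class, so these stay uncoloured;
    [sep] is allowed when distinct terminals of that class lie in distinct clusters. *)
Lemma combine_fans : routable dadj I S.
Proof.
pose c0 := exit_color P0 p0; pose c1 := exit_color P1 p1.
pose p s i := let: (b, x, y) := s in
  if b then rcons [seq (true, x, w) | w <- p1 y i] (false, x, last y (p1 y i))
  else rcons [seq (false, u, y) | u <- p0 x i] (true, last x (p0 x i), y).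
(* A vertex of a route is either its coloured end or an uncoloured vertex in the cluster of the
   terminal itself. *)
have memp v s i : s \in S -> v \in s :: p s i -> hub c0 c1 v = Some i \/
    [/\ hub c0 c1 v = None, v.1.1 = s.1.1 & if s.1.1 then v.1.2 = s.1.2 /\ v.2 \in s.2 :: p1 s.2 i
                          else v.2 = s.2 /\ v.1.2 \in s.1.2 :: p0 s.1.2 i].
  case: s => [[[] x] y] sS /=; rewrite -rcons_cons mem_rcons inE => /orP[/eqP->|].
  - by left; rewrite /hub /c0 /c1 /= (exit_color_last fp1) //; case: (S1 sS).
  - rewrite -(map_cons (fun w => (true, x, w))) => /mapP[w wq ->]; right; split=> //.
    by rewrite /hub /c0 /c1 /= (exit_color_forbidden fp0) //; case: (S1 sS).
  - by left; rewrite /hub /c0 /c1 /= (exit_color_last fp0) //; case: (S0 sS).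
  rewrite -(map_cons (fun w => (false, w, y))) => /mapP[w wq ->]; right; split=> //.
  by rewrite /hub /c0 /c1 /= (exit_color_forbidden fp1) //; case: (S0 sS).
have hubS s : s \in S -> hub c0 c1 s = None.
  case: s => [[[] x] y] sS; rewrite /hub /=.
    by apply: (exit_color_forbidden fp0); case: (S1 sS).
  by apply: (exit_color_forbidden fp1); case: (S0 sS).
have meet s t i j v : s \in S -> t \in S -> i != j -> v \in s :: p s i -> v \in t :: p t j ->
    s.1.1 = t.1.1 /\ if s.1.1 then [/\ v.1 = s.1, t.1 = s.1, v.2 \in s.2 :: p1 s.2 i & v.2 \in t.2 :: p1 t.2 j]
    else [/\ v.1.1 = s.1.1, v.2 = s.2, t.2 = s.2, v.1.2 \in s.1.2 :: p0 s.1.2 i & v.1.2 \in t.1.2 :: p0 t.1.2 j].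
  move=> sS tS ij /(memp _ _ _ sS) Hs /(memp _ _ _ tS) Ht.
  case: Hs Ht => [hv|[hv cv Hv]] [hv'|[hv' cv' Hv']].
  + by move: hv' ij; rewrite hv => -[->]; rewrite eqxx.
  + by rewrite hv in hv'.
  + by rewrite hv' in hv.
  case: s t v sS tS cv cv' Hv Hv' {hv hv'} => [[bs xs] ys] [[bt xt] yt] [[bv xv] yv] /= _ _ -> <-.
  by case: bs => -[-> ?] [-> ?].
exists (hub c0 c1), p; split.
- move=> [[[] x] y] i sS; rewrite /p rcons_path.
    apply/andP; split; last by rewrite (last_map (fun w => (true, x, w))) /= !eqxx.
    apply: (homo_path (f := fun w => (true, x, w)) (e := qadj setT)) => [a b ab|].
      by rewrite /= eqxx.
    by apply: (fan_path fp1); case: (S1 sS).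
  apply/andP; split; last by rewrite (last_map (fun w => (false, w, y))) /= !eqxx.
  apply: (homo_path (f := fun w => (false, w, y)) (e := qadj setT)) => [a b ab|].
    by rewrite /= eqxx.
  by apply: (fan_path fp0); case: (S0 sS).
- move=> [[[] x] y] i sS; rewrite /p last_rcons /hub /=.
    by apply: (exit_color_last fp1); case: (S1 sS).
  by apply: (exit_color_last fp0); case: (S0 sS).
- by move=> s i j v sS /(memp _ _ _ sS)[->|[-> _ _]] // [].
- move=> s t i j v sS tS ij vs vt; have [b] := meet s t i j v sS tS ij vs vt.
  case: s t v sS tS b {vs vt} => [[bs xs] ys] [[bt xt] yt] [[bv xv] yv] sS tS /= b.
  subst bt; case: bs sS tS => sS tS.
    case=> -[-> ->] [xE]; subst xt => vs vt.
    have := fan_meet fp1 (proj1 (S1 sS)) (proj1 (S1 tS)) (in_setT i) (in_setT j) ij _ vs vt.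
    by case=> [e|->|->]; [exact: sepS1 sS tS | left | right].
  case=> -> -> yE; subst yt => vs vt.
  have := fan_meet fp0 (proj1 (S0 sS)) (proj1 (S0 tS)) (in_setT i) (in_setT j) ij _ vs vt.
  by case=> [e|->|->]; [exact: sepS0 sS tS | left | right].
- move=> s t i j sS tS ij st ts; apply/negP => ss.
  have ts1 : t \in s :: p s i by rewrite inE ts orbT.
  have ss1 : s \in t :: p t j by rewrite inE ss orbT.
  have ts0 : t \in t :: p t j by rewrite mem_head.
  have ss0 : s \in s :: p s i by rewrite mem_head.
  have [b] := meet s t i j t sS tS ij ts1 ts0.
  have [_] := meet s t i j s sS tS ij ss0 ss1.
  case: s t sS tS b st {ts ss ts1 ss1 ts0 ss0} => [[bs xs] ys] [[bt xt] yt] sS tS /= b.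
  subst bt; case: bs sS tS => sS tS st.
    move=> [_ [xE] _ ss] [_ _ ts _]; subst xt.
    have yy : ys != yt by apply: contra st => /eqP->.
    have ns : ~~ sep1 by apply: contra yy => e; rewrite (sepS1 e sS tS).
    rewrite inE eq_sym (negbTE yy) /= in ts; rewrite inE (negbTE yy) /= in ss.
    have := fan_cross fp1 (proj1 (S1 sS)) (proj1 (S1 tS)) (in_setT i) (in_setT j) ij ns yy ts.
    by rewrite ss.
  move=> [_ _ yE _ ss] [_ _ _ ts _]; subst yt.
  have xx : xs != xt by apply: contra st => /eqP->.
  have ns : ~~ sep0 by apply: contra xx => e; rewrite (sepS0 e sS tS).
  rewrite inE eq_sym (negbTE xx) /= in ts; rewrite inE (negbTE xx) /= in ss.
  have := fan_cross fp0 (proj1 (S0 sS)) (proj1 (S0 tS)) (in_setT i) (in_setT j) ij ns xx ts.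
  by rewrite ss.
by apply: hub_connected; [exact: exit_color_onto fp0 P0n | exact: exit_color_onto fp1 P1n].
Qed.

End Combine.
End DualCube.

(** * Four terminals *)

Section Cases.
Variable I : finType.
Hypothesis I3 : 2 < #|I|.

(* The only case that does not split into two independent fan systems: the
   neighbours a, flip i0 a share the cluster y, and the other two terminals lie in
   the clusters a and flip i0 a.  In colour i0 each of the first two terminals
   crosses into the opposite cluster, where y is treated as a third terminal. *)
Lemma crossed_routable (a y yb yc : {set I}) (i0 : I) p1 :
  fan_system setT [:: yb; yc; y] [:: y] [:: y] false p1 ->
  routable (@dadj I) I
    [:: (false, a, y); (false, flip i0 a, y); (true, flip i0 a, yb); (true, a, yc)].
Proof.
move=> fp1; set a' := flip i0 a; set S := [:: _; _; _; _]; set P1 := [:: yb; yc; y] in fp1.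
have [i1 [i2 [i10 i20 i12]]] : exists i1 i2, [/\ i1 != i0, i2 != i0 & i1 != i2].
  have : 1 < #|[set~ i0]| by rewrite cardsC1; case: #|I| I3.
  by case/card_gt1P => i1 [i2 []]; rewrite !inE => *; exists i1, i2.
have aoff i : i != i0 -> (i \in a') = (i \in a) by apply: in_flip_neq.
have a0 : (i0 \in a') = ~~ (i0 \in a) by apply: in_flip.
have aa' : a != a' by rewrite eq_sym flip_neq.
(* Every colour needs a cluster of class true, but no route of colour [i0] ends in one. A point at
   distance 2 from [a], in two directions other than [i0], differs from [a], [a'] and all the other
   exits. *)
pose far := flip i1 (flip i2 a).
pose c0 x := if x == far then Some i0
  else [pick i | (i != i0) && ((x == flip i a) || (x == flip i a'))].
pose c1 := exit_color P1 p1; pose h := hub c0 c1.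
have flip_eq i j x x' : x \in [:: a; a'] -> x' \in [:: a; a'] -> i != i0 -> j != i0 ->
    flip i x = flip j x' -> x = x' /\ i = j.
  move=> xa xa' i_0 j_0 e; have xx : x = x'.
    have /setP/(_ i0) := e; rewrite !in_flip_neq 1?eq_sym //.
    move: xa xa'; rewrite !inE => /orP[] /eqP-> /orP[] /eqP-> //; rewrite a0;
    by case: (i0 \in a).
  split=> //; apply/eqP; rewrite -xx in e; have /setP/(_ i) := e.
  by rewrite !inE eqxx; case: (i == j) => //; case: (i \in x).
have flip_far i x : x \in [:: a; a'] -> i != i0 -> (flip i x == far) = false.
  move=> xa i_0; apply/eqP => e; have /setP/(_ i0) := e.
  rewrite /far !in_flip_neq 1?eq_sym //; move: xa e; rewrite !inE => /orP[] /eqP->; last first.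
    by rewrite a0; case: (i0 \in a).
  move=> /setP e _; have := e i1; have := e i2; rewrite !inE !eqxx [i2 == i1]eq_sym (negbTE i12) /=.
  by case: (i2 =P i) => [<-|_]; rewrite ?(negbTE i12); case: (i1 \in a); case: (i2 \in a).
have c0_flip i x : x \in [:: a; a'] -> i != i0 -> c0 (flip i x) = Some i.
  move=> xa i_0; rewrite /c0 flip_far //; case: pickP => [j /andP[j_0 /orP[]/eqP e]|].
  - by have [] := flip_eq i j x a xa _ i_0 j_0 e; rewrite ?mem_head // => _ ->.
  - by have [] := flip_eq i j x a' xa _ i_0 j_0 e; rewrite ?inE ?eqxx ?orbT // => _ ->.
  move=> /(_ i); rewrite i_0 /=; move: xa; rewrite !inE => /orP[] /eqP ->; by rewrite eqxx ?orbT.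
have flip_out i x x' : x \in [:: a; a'] -> x' \in [:: a; a'] -> i != i0 -> flip i x <> x'.
  move=> xa xa' i_0 /setP/(_ i); rewrite in_flip.
  have off z : z \in [:: a; a'] -> (i \in z) = (i \in a).
    by rewrite !inE => /orP[] /eqP-> //; apply: aoff.
  by rewrite !off //; case: (i \in a).
have c0_S x : x \in [:: a; a'] -> c0 x = None.
  move=> xa; rewrite /c0; case: eqP => [e|_].
    have /setP/(_ i1) := e; rewrite /far in_flip in_flip_neq //; move: xa; rewrite !inE.
    by case/orP=> /eqP->; rewrite ?aoff //; case: (i1 \in a).
  case: pickP => // i /andP[i_0 /orP[] /eqP e];
  by case: (flip_out i _ x _ xa i_0 (esym e)); rewrite !inE eqxx ?orbT.
have yP : y \in P1 by rewrite !inE eqxx !orbT.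
have c1y : c1 y = None by apply: (exit_color_forbidden fp1); rewrite mem_head.
have S0 x z : (false, x, z) \in S -> x \in [:: a; a'] /\ z = y.
  by rewrite !inE => /or4P[] /eqP // [-> ->]; rewrite eqxx ?orbT.
have S1 x z : (true, x, z) \in S -> x \in [:: a; a'] /\ z \in P1.
  by rewrite !inE => /or4P[] /eqP // [-> ->]; rewrite !eqxx ?orbT.
have S1u x z z' : (true, x, z) \in S -> (true, x, z') \in S -> z = z'.
  have zE z1 : (true, x, z1) \in S -> z1 = if x == a then yc else yb.
    by rewrite !inE => /or4P[] /eqP // [-> ->]; rewrite ?eqxx // eq_sym (negbTE aa').
  by move=> /zE -> /zE ->.
(* For a colour other than [i0], a terminal of class false steps in direction [i] and crosses. In
   colour [i0] it crosses at once, follows the path of [p1] from [y], and crosses back. *)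
pose p s i := let: (b, x, z) := s in
  if b || (i == i0) then
    (if b then [::] else [:: (true, x, z)]) ++
      rcons [seq (true, x, w) | w <- p1 z i] (false, x, last z (p1 z i))
  else [:: (false, flip i x, z); (true, flip i x, z)].
have memp (v s : vert I) i : s \in S -> v \in s :: p s i -> h v = Some i \/ h v = None /\
    if v.1.1 then [/\ v.1.2 = s.1.2, v.2 \in s.2 :: p1 s.2 i & s.1.1 || (i == i0)]
    else s.1.1 = false /\ (v = s \/ i != i0 /\ v = (false, flip i s.1.2, s.2)).
  case: s => [[[] x] z] sS.
    rewrite /p /= -rcons_cons mem_rcons inE => /orP[/eqP->|].
      left; rewrite /h /hub /c1 /= (exit_color_last fp1) //; by case: (S1 _ _ sS).
    rewrite -(map_cons (fun w => (true, x, w))) => /mapP[w wq ->]; right; split=> //.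
    by rewrite /h /hub /= c0_S //; case: (S1 _ _ sS).
  have [xa zy] := S0 _ _ sS; subst z; rewrite inE => /orP[/eqP->|].
    by right; split; [rewrite /h /hub | split; [|left]].
  rewrite /p /=; case: (eqVneq i i0) => [->|i_0] /=.
    rewrite -rcons_cons mem_rcons inE => /orP[/eqP->|].
      by left; rewrite /h /hub /c1 /= (exit_color_last fp1).
    rewrite -(map_cons (fun w => (true, x, w))) => /mapP[w wq ->]; right; split=> //.
    by rewrite /h /hub /= c0_S.
  rewrite !inE => /orP[] /eqP->; last by left; rewrite /h /hub /= c0_flip.
  by right; split; [rewrite /h /hub | split; [|right]].
have hS s : s \in S -> h s = None.
  by case: s => [[[] x] z] sS; rewrite /h /hub /=; [apply: c0_S; case: (S1 _ _ sS) | case: (S0 _ _ sS) => _ ->].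
have inP1 s : s \in S -> s.2 \in P1.
  by case: s => [[[] x] z] sS; [case: (S1 _ _ sS) | case: (S0 _ _ sS) => _ ->].
(* A route of colour [i0] enters an opposite cluster at [y]. The tails of [p1] avoid [y], so another
   path contains this point only as its start. *)
have avoidy z i : z \in P1 -> y \in z :: p1 z i -> y = z.
  move=> zP; rewrite inE => /orP[/eqP//|yp].
  by have := fan_avoid fp1 zP (in_setT i) yp; rewrite mem_head.
exists h, p; split.
- have cross_path x z i : z \in P1 ->
    path (@dadj I) (true, x, z) (rcons [seq (true, x, w) | w <- p1 z i] (false, x, last z (p1 z i))).
    move=> zP; rewrite rcons_path.
    apply/andP; split; last by rewrite (last_map (fun w => (true, x, w))) /= !eqxx.
    apply: (homo_path (f := fun w => (true, x, w)) (e := qadj setT)) => [u v uv|].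
      by rewrite /= eqxx.
    exact (fan_path fp1 zP (in_setT i)).
  move=> [[[] x] z] i sS; rewrite /p.
    by apply: cross_path; case: (S1 _ _ sS).
  case: eqP => [_|_] /=; last by rewrite !eqxx qadj_flip ?inE.
  by rewrite !eqxx /=; apply: cross_path; case: (S0 _ _ sS) => _ ->.
- move=> s i sS; case: s sS => [[[] x] z] sS; rewrite /p /=.
    by rewrite last_rcons /h /hub /c1 /= (exit_color_last fp1) //; case: (S1 _ _ sS).
  have [xa ->] := S0 _ _ sS.
  by case: (eqVneq i i0) => [->|i_0] /=; rewrite ?last_rcons /h /hub /c1 /= ?(exit_color_last fp1) ?c0_flip.
- by move=> s i j v sS /(memp _ _ _ sS)[->|[-> _]] // [].
- move=> s t i j v sS tS ij /(memp _ _ _ sS) Hs /(memp _ _ _ tS) Ht.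
  case: Hs Ht => [hv|[hv Hs]] [hv'|[hv' Ht]].
  + by move: hv' ij; rewrite hv => -[->]; rewrite eqxx.
  + by rewrite hv in hv'.
  + by rewrite hv' in hv.
  case: v {hv hv'} Hs Ht => [[[] x] z] /=; last first.
    move=> [s0 [->|[i_0 vs]]]; first by left.
    move=> [t0 [->|[j_0 vt]]]; first by right.
    case: s t s0 t0 sS tS vs vt => [[bs xs] ys] [[bt xt] yt] /= -> -> /S0[xsa _] /S0[xta _] [-> _] [e _].
    by have [_ e'] := flip_eq i j xs xt xsa xta i_0 j_0 e; rewrite e' eqxx in ij.
  move=> [xs zs si] [xt zt tj].
  have := fan_meet fp1 (inP1 s sS) (inP1 t tS) (in_setT i) (in_setT j) ij (fun f => False_ind _ (notF f)) zs zt.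
  case: s t sS tS xs xt zs zt si tj => [[bs xs] ys] [[bt xt] yt] /= sS tS -> xE.
  subst xt; case: bs sS => sS zs zt si tj [] zE; subst z.
  + by left.
  + case: bt tS tj => tS tj; first by right.
    by left; have [_ yt'] := S0 _ _ tS; subst yt; rewrite -(avoidy ys i (inP1 _ sS) zs).
  + have [_ ys'] := S0 _ _ sS; subst ys; case: bt tS tj => tS tj.
      by right; rewrite -(avoidy yt j (inP1 _ tS) zt).
    by move: ij; rewrite (eqP si) (eqP tj) eqxx.
  case: bt tS tj => tS tj; first by right.
  by move: ij; rewrite (eqP si) (eqP tj) eqxx.
- move=> s t i j sS tS ij st ts; apply/negP => ss.
  have := memp t s i sS; rewrite inE ts orbT => /(_ isT); rewrite hS // => -[//|[_ Ht]].
  have := memp s t j tS; rewrite inE ss orbT => /(_ isT); rewrite hS // => -[//|[_ Hs]].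
  case: t tS st Ht {ts ss} Hs => [[[] xt] yt] tS st /=.
    case: s sS st => [[[] xs] ys] sS st /= [xE _ _]; last by case.
    by subst xt; rewrite (S1u _ _ _ sS tS) eqxx in st.
  case=> s0 [e|[i_0 e]] _; first by rewrite e eqxx in st.
  case: s s0 sS e {st} => [[bs xs] ys] /= -> /S0[xa _] [e _].
  by have [xa' _] := S0 _ _ tS; case: (flip_out i xs xt xa xa' i_0); rewrite e.
apply: hub_connected; last exact: exit_color_onto fp1 _.
move=> i; have [->|i_0] := eqVneq i i0; first by exists far; rewrite /c0 eqxx.
by exists (flip i a); apply: c0_flip; rewrite // mem_head.
Qed.


Notation all_codes := (codes3 ++ codesI) (only parsing).

(** These are the splittings of the four terminals other than two and two. In [(1, 0)] a class has
    no terminal: mark 0 is a dummy that only provides exits of every colour, and all four marks are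
    forbidden. *)
Lemma solvable_anywhere pn fn : (pn, fn) \in [:: (1, 0); (1, 1); (3, 3); (4, 4)] ->
  all (solvable pn fn false false) [seq s <- all_codes | xpredT s].
Proof.
have H : all (fun q => all (solvable q.1 q.2 false false) [seq s <- all_codes | xpredT s])
             [:: (1, 0); (1, 1); (3, 3); (4, 4)] by vm_compute.
by move=> /(allP H).
Qed.

Lemma solvable_not_crossed :
  all (solvable 2 2 false false) [seq s <- all_codes | not_crossed s].
Proof. by vm_compute. Qed.

(** Two terminals in different clusters: only the end points of their paths can conflict, so the
    crossed configurations are solvable too. *)
Lemma solvable_separate : all (solvable 2 2 false true) [seq s <- all_codes | xpredT s].
Proof. by vm_compute. Qed.

(** In these types the bits for marks 2 and 3 coincide, as happens when the last mark is
    repeated. *)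
Definition repeated_last (s : seq nat) : bool := all (mem [:: 0; 1; 6; 7]) s.

Lemma solvable_avoiding :
  all (solvable 3 3 true false) [seq s <- all_codes | repeated_last s].
Proof. by vm_compute. Qed.

Notation mk := (marks_fan [set: I]).

Lemma marks_fanT pn fn (av sep : bool) (ok : seq nat -> bool) (m0 m1 m2 m3 : {set I}) :
  all (solvable pn fn av sep) [seq s <- all_codes | ok s] ->
  (forall s s', perm_eq s s' -> ok s -> ok s') ->
  (forall s, 2 < size s -> ok (0 :: s) -> ok s) ->
  (forall s c, 2 < size s -> 0 \notin s -> c \in s -> ok (c :: s) -> ok s) ->
  ok [seq code [:: m0; m1; m2; m3] j | j <- enum [set: I]] -> mk pn fn av sep [:: m0; m1; m2; m3].
Proof.
move=> h1 h2 h3 h4; apply: marks_fan_ind h1 h2 h3 h4 _ _ _ _ _ _ _; first by rewrite cardsT.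
by move=> x; rewrite inE.
Qed.

Lemma marks_fan_anywhere pn fn (m0 m1 m2 m3 : {set I}) :
  (pn, fn) \in [:: (1, 0); (1, 1); (3, 3); (4, 4)] -> mk pn fn false false [:: m0; m1; m2; m3].
Proof. by move=> /solvable_anywhere H; apply: (marks_fanT H). Qed.

Lemma marks_fan_separate (m0 m1 m2 m3 : {set I}) : mk 2 2 false true [:: m0; m1; m2; m3].
Proof. exact: (marks_fanT solvable_separate). Qed.

Lemma marks_fan_not_crossed (m0 m1 m2 m3 : {set I}) :
  not_crossed [seq code [:: m0; m1; m2; m3] j | j <- enum [set: I]] ->
  mk 2 2 false false [:: m0; m1; m2; m3].
Proof.
apply: (marks_fanT solvable_not_crossed) => [s s' ss'|s s2|s c s2 s0 _ _].
- by rewrite /not_crossed (permP ss') (perm_size ss') !(perm_mem ss').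
- rewrite /not_crossed; apply: contra => /andP[/eqP e H3].
  by rewrite !in_cons /= H3 e add1n prednK ?eqxx // (leq_trans _ s2).
(* Without type 0 the count is 0, whereas a crossed list of this length would need a positive
   one. *)
rewrite /not_crossed negb_and (count_memPn s0); apply/orP; left.
by case: s s2 {s0} => [|? []].
Qed.

Lemma marks_fan_avoiding (y0 y1 y : {set I}) : mk 3 3 true false [:: y0; y1; y; y].
Proof.
apply: (marks_fanT solvable_avoiding) => [s s' ss'|s _|s c _ _ _|].
- by rewrite /repeated_last (perm_all _ ss').
- by case/andP.
- by case/andP.
by apply/allP => _ /mapP[j _ ->]; rewrite /code /=; do 2 case: (_ (+) _).
Qed.

(** Type 3 says that marks 1 and 2 differ from mark 0, type 5 that marks 1 and 3 do. As all other
    coordinates have type 0, this single flip is the whole difference. *)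
Lemma crossedP (m0 m1 m2 m3 : {set I}) :
  ~~ not_crossed [seq code [:: m0; m1; m2; m3] j | j <- enum [set: I]] ->
  exists i0, m1 = flip i0 m0 /\ ((m2 = m1 /\ m3 = m0) \/ (m2 = m0 /\ m3 = m1)).
Proof.
set M := [:: _; _; _; _]; rewrite negbK size_map -cardE cardsT => /andP[/eqP cnt H].
have [i0 ci0] : exists i0, code M i0 = 3 \/ code M i0 = 5.
  by case/orP: H => /mapP[i _ ->]; exists i; [left|right].
have z j : j != i0 -> code M j = 0.
  move=> ji; apply/eqP; apply: contraT => cj.
  have : count (predC (pred1 0)) [seq code M j | j <- enum [set: I]] = 1.
    have := count_predC (pred1 0) [seq code M j | j <- enum [set: I]].
    rewrite cnt size_map -cardE cardsT -[in RHS](prednK (ltnW (ltnW I3))) -addn1.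
    exact: addnI.
  rewrite count_map; set q := preim _ _ => cq.
  have : 1 < count q (enum [set: I]).
    rewrite -size_filter; apply: (@uniq_leq_size _ [:: j; i0]); first by rewrite /= inE ji.
    move=> k; rewrite mem_filter mem_enum in_setT andbT !inE => /orP[]/eqP->; rewrite /q /= ?cj //.
    by case: ci0 => ->.
  by rewrite cq.
have bits j : code M j = 0 -> [/\ (j \in m1) = (j \in m0), (j \in m2) = (j \in m0) & (j \in m3) = (j \in m0)].
  by rewrite /code /=; case: (j \in m0); case: (j \in m1); case: (j \in m2); case: (j \in m3).
have ext (m : {set I}) b : (forall j, j != i0 -> (j \in m) = (j \in m0)) -> (i0 \in m) = b (+) (i0 \in m0) ->
    m = if b then flip i0 m0 else m0.
  move=> e e0; apply/setP => j; case: (eqVneq j i0) => [->|ji].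
    by rewrite e0; case: b {e0}; rewrite ?in_flip.
  by case: b {e0}; rewrite ?in_flip_neq // e.
have e1 j : j != i0 -> (j \in m1) = (j \in m0) by move/z/bits=> [].
have e2 j : j != i0 -> (j \in m2) = (j \in m0) by move/z/bits=> [].
have e3 j : j != i0 -> (j \in m3) = (j \in m0) by move/z/bits=> [].
exists i0; have : (i0 \in m1) (+) (i0 \in m0) /\ ((i0 \in m2) (+) (i0 \in m0) = ~~ ((i0 \in m3) (+) (i0 \in m0))).
  by move: ci0; rewrite /code /=; case: (i0 \in m0); case: (i0 \in m1); case: (i0 \in m2); case: (i0 \in m3) => -[].
move=> [b1 b23].
have E1 : m1 = flip i0 m0 by apply: (ext m1 true e1); move: b1; case: (i0 \in m0); case: (i0 \in m1).
split=> //; rewrite E1; case: (boolP ((i0 \in m3) (+) (i0 \in m0))) b23 => b3 b2.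
  right; split; first by apply: (ext m2 false e2); move: b2; case: (i0 \in m0); case: (i0 \in m2).
  by apply: (ext m3 true e3); move: b3; case: (i0 \in m0); case: (i0 \in m3).
left; split; first by apply: (ext m2 true e2); move: b2; case: (i0 \in m0); case: (i0 \in m2).
by apply: (ext m3 false e3); move: b3; case: (i0 \in m0); case: (i0 \in m3).
Qed.

Lemma crossed_routable_marks (x0 x1 x2 x3 y y2 y3 : {set I}) :
  ~~ not_crossed [seq code [:: x0; x1; x2; x3] j | j <- enum [set: I]] ->
  routable (@dadj I) I [:: (false, x0, y); (false, x1, y); (true, x2, y2); (true, x3, y3)].
Proof.
move=> /crossedP[i0 [-> [[-> ->]|[-> ->]]]].
  by have [p1 fp1] := marks_fan_avoiding y2 y3 y; apply: crossed_routable fp1.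
have [p1 fp1] := marks_fan_avoiding y3 y2 y.
apply: routable_eq_mem (crossed_routable x0 i0 fp1) => s.
by rewrite !inE; congr (_ || (_ || _)); rewrite orbC.
Qed.

(** Here [n0] counts the terminals of class false. The y-parts are listed in reverse so that the
    terminals of class true come first; [maxn _ 1] supplies the dummy terminal of an empty class. *)
Lemma routable_of_marks n0 (x0 x1 x2 x3 y0 y1 y2 y3 : {set I}) (sep0 sep1 : bool) : n0 <= 4 ->
  mk (maxn n0 1) n0 false sep0 [:: x0; x1; x2; x3] ->
  mk (maxn (4 - n0) 1) (4 - n0) false sep1 [:: y3; y2; y1; y0] ->
  (sep0 -> n0 = 2 /\ y0 != y1) -> (sep1 -> n0 = 2 /\ x2 != x3) ->
  routable (@dadj I) I [:: (n0 <= 0, x0, y0); (n0 <= 1, x1, y1); (n0 <= 2, x2, y2); (n0 <= 3, x3, y3)].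
Proof.
move=> n04 [p0 fp0] [p1 fp1] s0 s1.
have {}s0 : sep0 -> n0 = 2 /\ (y0 == y1) = false by move=> /s0[-> /negbTE].
have {}s1 : sep1 -> n0 = 2 /\ (x2 == x3) = false by move=> /s1[-> /negbTE].
case: n0 n04 fp0 fp1 s0 s1 => [|[|[|[|[|//]]]]] _ fp0 fp1 s0 s1;
  (apply: (combine_fans fp0 fp1) => [||x y|x y|x x' y|x y y'];
   [ by [] | by [] | by rewrite !inE => /or4P[] /eqP // [-> ->]; rewrite !eqxx ?orbT
   | by rewrite !inE => /or4P[] /eqP // [-> ->]; rewrite !eqxx ?orbT
   | move=> /s0[] // _ ny | move=> /s1[] // _ nx]).
- rewrite !inE => /or4P[] /eqP // [-> ->] /or4P[] /eqP // [] // -> e; move: ny;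
  by rewrite e eqxx.
rewrite !inE => /or4P[] /eqP // [-> ->] /or4P[] /eqP // [] // e ->; move: nx;
by rewrite e eqxx.
Qed.

Lemma routable_sorted n0 (x0 x1 x2 x3 y0 y1 y2 y3 : {set I}) : n0 <= 4 ->
  routable (@dadj I) I [:: (n0 <= 0, x0, y0); (n0 <= 1, x1, y1); (n0 <= 2, x2, y2); (n0 <= 3, x3, y3)].
Proof.
move=> n04; have [n2|n2] := eqVneq n0 2; last first.
  apply: (routable_of_marks (sep0 := false) (sep1 := false)) => //; apply: marks_fan_anywhere;
  by case: n0 n04 n2 => [|[|[|[|[|]]]]].
rewrite {n0}n2 in n04 *.
(* Paths in a common cluster are possible unless the marks are crossed; in the crossed case distinct
   clusters [c] and [d] permit [sep]. *)
have fan_of (m0 m1 m2 m3 : {set I}) (c d : {set I}) :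
    (not_crossed [seq code [:: m0; m1; m2; m3] j | j <- enum [set: I]] || (c != d)) ->
    exists2 sep : bool, mk 2 2 false sep [:: m0; m1; m2; m3] & sep -> c != d.
  case: (boolP (not_crossed _)) => [nc _|_ /= cd].
    by exists false => //; apply: marks_fan_not_crossed.
  by exists true => //; apply: marks_fan_separate.
case: (boolP (not_crossed [seq code [:: x0; x1; x2; x3] j | j <- enum [set: I]] || (y0 != y1))); last first.
  by rewrite negb_or negbK => /andP[cx /eqP ->]; apply: crossed_routable_marks.
move=> /fan_of[sep0 fx s0].
case: (boolP (not_crossed [seq code [:: y3; y2; y1; y0] j | j <- enum [set: I]] || (x2 != x3))); last first.
  (* The crossed pair is now in class true; exchanging the classes reduces to the previous case. *)
  rewrite negb_or negbK => /andP[cy /eqP ->]; apply: routable_swap.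
  apply: routable_eq_mem (crossed_routable_marks x3 x1 x0 cy) => s.
  by rewrite !inE /=; do 4 case: (_ == _).
move=> /fan_of[sep1 fy s1].
by apply: (@routable_of_marks 2 _ _ _ _ _ _ _ _ sep0 sep1 isT fx fy); [move/s0|move/s1].
Qed.

Lemma routable_size4 (S : seq (vert I)) : size S = 4 -> routable (@dadj I) I S.
Proof.
move=> S4; pose S0 := [seq s <- S | ~~ s.1.1]; pose S1 := [seq s <- S | s.1.1].
have sz : size S0 + size S1 = 4 by rewrite !size_filter addnC count_predC.
have mS : S0 ++ S1 =i S by move=> s; rewrite mem_cat !mem_filter; case: s.1.1; rewrite ?orbF.
have b0 s : s \in S0 -> s.1.1 = false by rewrite mem_filter => /andP[/negbTE].
have b1 s : s \in S1 -> s.1.1 = true by rewrite mem_filter => /andP[].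
apply: (routable_eq_mem mS).
(* With class false listed first, the class of the terminal at position [r] depends only on the
   number of terminals of class false. *)
have nb r : r < 4 -> (nth (true, set0, set0) (S0 ++ S1) r).1.1 = (size S0 <= r).
  move=> r4; rewrite nth_cat; case: ltnP => h; first by rewrite b0 ?mem_nth.
  by rewrite b1 // mem_nth // ltn_subLR // sz.
have n04 : size S0 <= 4 by rewrite -sz leq_addr.
move: nb n04; rewrite -size_cat in sz; move: (size S0) => n0.
case: (S0 ++ S1) sz => [|[[c0 x0] y0] [|[[c1 x1] y1] [|[[c2 x2] y2] [|[[c3 x3] y3] []]]]] //= _ nb n04.
move: (nb 0 isT) (nb 1 isT) (nb 2 isT) (nb 3 isT) => /= -> -> -> ->.
exact: routable_sorted.
Qed.

End Cases.

(** * The dual cube *)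

Section UpperBound.
Variables (T : finType) (adj : rel T).
Hypothesis adj_sym : symmetric adj.

Lemma connect_first_step (R : rel T) (x y : T) :
  connect R x y -> x != y -> exists z, R x z.
Proof.
by case/connectP=> -[|z p] /= pth ->; rewrite ?eqxx // => _; exists z; case/andP: pth.
Qed.

Section Trees.
Variables (S : {set T}) (m : nat) (VT : 'I_m -> {set T}) (ET : 'I_m -> {set {set T}}).
Hypothesis treeVE : forall i, is_tree adj (VT i) (ET i) && (S \subset VT i).
Hypothesis ET_disj : forall i j, i != j -> [disjoint ET i & ET j].

Lemma tree_edge_adj i x y : [set x; y] \in ET i -> adj x y.
Proof.
have /andP[/and4P[_ /forall_inP sub _ _] _] := treeVE i.
move=> /sub /existsP[a /existsP[b /and4P[_ _ ab /eqP e]]].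
exact: rel_set2 adj_sym e ab.
Qed.

Lemma tree_edge_exists i x : x \in S -> 1 < #|S| -> exists y, [set x; y] \in ET i.
Proof.
move=> xS /card_gt1P[a [b [aS bS ab]]].
have [s sS xs] : exists2 s, s \in S & x != s.
  by have [xa|xa] := eqVneq x a; [exists b; rewrite // xa | exists a].
have /andP[/and4P[_ _ /forall_inP con _] /subsetP sub] := treeVE i.
have /forall_inP/(_ s (sub _ sS)) := con x (sub _ xS).
by case/connect_first_step=> // y; exists y.
Qed.

Lemma edge_tree_inj i j x y : [set x; y] \in ET i -> [set x; y] \in ET j -> i = j.
Proof.
move=> ei ej; apply/eqP; apply: contraT => /ET_disj/pred0P/(_ [set x; y]) /=.
by rewrite ei ej.
Qed.

(** Choosing an edge at [x] in each tree injects the trees into the neighbours of [x]. If the degree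
    is no larger than [m] this is a bijection, so a second edge of a tree at [x] would already
    belong to another tree. *)
Lemma card_trees_le_degree x : x \in S -> 1 < #|S| ->
  m <= #|adj x| /\ (#|adj x| <= m ->
    (forall y, adj x y -> exists i, [set x; y] \in ET i) /\
    (forall i y z, [set x; y] \in ET i -> [set x; z] \in ET i -> y = z)).
Proof.
move=> xS S1; have /fin_all_exists[w Hw] i := tree_edge_exists i xS S1.
have w_inj : injective w by move=> i j e; apply: edge_tree_inj (Hw i) _; rewrite e.
have sub : w @: [set: 'I_m] \subset adj x.
  by apply/subsetP => _ /imsetP[i _ ->]; apply: tree_edge_adj (Hw i).
have cw : #|w @: [set: 'I_m]| = m by rewrite card_imset // cardsT card_ord.
split; first by rewrite -{1}cw subset_leq_card.
rewrite -{1}cw => le.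
have eqw : w @: [set: 'I_m] =i adj x 
  by apply/subset_cardP => //; apply/eqP; rewrite eqn_leq (subset_leq_card sub).
have ex y : adj x y -> exists i, y = w i.
  move=> xy; have : y \in w @: [set: 'I_m] by rewrite eqw unfold_in.
  by case/imsetP => i _ ->; exists i.
split=> [y /ex[i ->]|i y z]; first by exists i.
move=> ey ez; have [a ya] := ex y (tree_edge_adj ey); have [b zb] := ex z (tree_edge_adj ez).
rewrite ya zb; congr w; rewrite ya in ey; rewrite zb in ez.
by rewrite (edge_tree_inj (Hw a) ey) (edge_tree_inj (Hw b) ez).
Qed.

End Trees.

Lemma has_S_trees_lt_degree (S : {set T}) (u v : T) (d m : nat) :
  u \in S -> v \in S -> 2 < #|S| -> adj u v -> #|adj u| <= d -> #|adj v| <= d ->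
  has_S_trees adj S m -> m < d.
Proof.
move=> uS vS S2 uv du dv /existsP[VT /existsP[ET /andP[/forallP tr /forallP dj]]].
have disj i j : i != j -> [disjoint ET i & ET j].
  by move=> ij; have /forallP/(_ j)/implyP/(_ ij)/andP[] := dj i.
have S1 : 1 < #|S| by apply: ltnW.
have [mu Hu] := card_trees_le_degree tr disj uS S1.
have [mv Hv] := card_trees_le_degree tr disj vS S1.
rewrite ltnNge; apply/negP => dm.
have [exu unu] := Hu (leq_trans du dm); have [_ unv] := Hv (leq_trans dv dm).
have [i ei] := exu v uv.
(* The tree containing [uv] has no other edge at [u] or [v], so the pair is closed under its
   edges. *)
have cl a b : a \in [set u; v] -> erel (ET i) a b -> b \in [set u; v].
  rewrite !inE => /orP[] /eqP-> eb; first by rewrite (unu i b v eb ei) eqxx orbT.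
  by rewrite (unv i b u eb) ?eqxx // setUC.
have [s sS suv] : exists2 s, s \in S & s \notin [set u; v].
  apply/subsetPn; apply: contraL S2 => /subset_leq_card; rewrite cards2 -leqNgt => le.
  by apply: leq_trans le _; case: eqP.
have /andP[/and4P[_ _ /forall_inP con _] /subsetP sub] := tr i.
have /forall_inP/(_ s (sub _ sS))/connectP[p pth sE] := con u (sub _ uS).
have stay q x : path (erel (ET i)) x q -> x \in [set u; v] -> last x q \in [set u; v].
  by elim: q x => //= z q IH x /andP[xz pz] xuv; apply: IH pz (cl x z xuv xz).
by case/negP: suv; rewrite sE; apply: stay; rewrite // !inE eqxx.
Qed.

End UpperBound.

(** * Identification with bit strings *)

Section DualCubeGraph.
Variable k : nat.
Local Notation n := k.+1.
Local Notation N := (2 * n).-1.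

Lemma dim_eq : N = k + k + 1.
Proof. by rewrite mul2n -addnn addSn /= addnS addn1. Qed.

Definition dc_bit (s : vert 'I_k) (r : nat) : bool :=
  let: (b, x, y) := s in
  if r < k then [exists j in x, val j == r]
  else if r < k + k then [exists j in y, k + val j == r] else b.

Definition to_dc (s : vert 'I_k) : dc_vertex n := [ffun r : 'I_N => dc_bit s r].

Lemma idx_x_lt (j : 'I_k) : j < N.
Proof. by rewrite dim_eq -addnA ltn_addr. Qed.
Lemma idx_y_lt (j : 'I_k) : k + j < N.
Proof. by rewrite dim_eq ltn_addr // ltn_add2l. Qed.
Lemma idx_b_lt : k + k < N.
Proof. by rewrite dim_eq addn1. Qed.

Definition idx_x (j : 'I_k) : 'I_N := Ordinal (idx_x_lt j).
Definition idx_y (j : 'I_k) : 'I_N := Ordinal (idx_y_lt j).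
Definition idx_b : 'I_N := Ordinal idx_b_lt.

Definition of_dc (u : dc_vertex n) : vert 'I_k :=
  (u idx_b, [set j | u (idx_x j)], [set j | u (idx_y j)]).

Lemma to_dc_x b x y j : to_dc (b, x, y) (idx_x j) = (j \in x).
Proof.
rewrite ffunE /= ltn_ord; apply/exists_inP/idP => [[i ix /eqP/val_inj <-]//|jx].
by exists j.
Qed.

Lemma to_dc_y b x y j : to_dc (b, x, y) (idx_y j) = (j \in y).
Proof.
rewrite ffunE /= ltnNge leq_addr /= ltn_add2l ltn_ord.
apply/exists_inP/idP => [[i iy]|jy]; last by exists j.
by rewrite eqn_add2l => /eqP/val_inj <-.
Qed.

Lemma to_dc_b b x y : to_dc (b, x, y) idx_b = b.
Proof. by rewrite ffunE /= ltnNge leq_addr ltnn. Qed.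

Variant idx_spec : 'I_N -> Type :=
  | IdxX j : idx_spec (idx_x j)
  | IdxY j : idx_spec (idx_y j)
  | IdxB : idx_spec idx_b.

Lemma idxP r : idx_spec r.
Proof.
have [rk|rk] := ltnP r k.
  suff -> : r = idx_x (Ordinal rk) by constructor.
  exact: val_inj.
have [rkk|rkk] := ltnP r (k + k).
  have rk' : r - k < k by rewrite ltn_subLR.
  suff -> : r = idx_y (Ordinal rk') by constructor.
  by apply: val_inj; rewrite /= subnKC.
suff -> : r = idx_b by constructor.
apply: val_inj; apply/eqP; rewrite /= eqn_leq rkk andbT.
by have := ltn_ord r; rewrite [X in _ < X]dim_eq addn1.
Qed.

Lemma of_dcK : cancel of_dc to_dc.
Proof.
by move=> u; apply/ffunP => r; case: (idxP r) => [j|j|]; rewrite ?(to_dc_x, to_dc_y, to_dc_b) ?inE.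
Qed.

Lemma to_dcK : cancel to_dc of_dc.
Proof.
move=> [[b x] y]; congr (_, _, _); first exact: to_dc_b.
  by apply/setP => j; rewrite inE to_dc_x.
by apply/setP => j; rewrite inE to_dc_y.
Qed.

Lemma dc_adjE (u v : dc_vertex n) : dc_adj u v =
  [exists i : 'I_N, [forall j, (u j == v j) == (j != i)] &&
     (if i < k then ~~ u idx_b && ~~ v idx_b
      else if i < k + k then u idx_b && v idx_b else true)].
Proof.
apply: eq_existsb => i; congr (_ && _).
have -> : (2 * n).-2 = k + k by rewrite -[(2 * n).-2]/(N.-1) dim_eq addn1.
apply/forallP/idP => [/(_ idx_b)|H r]; first by rewrite eqxx.
by apply/implyP => /eqP rE; have -> : r = idx_b by apply: val_inj.
Qed.

Lemma dc_adj_sym : symmetric (@dc_adj n).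
Proof.
move=> u v; rewrite !dc_adjE; apply: eq_existsb => i.
congr (_ && _); first by apply: eq_forallb => j; rewrite (eq_sym (u j)).
by case: ifP => _; [|case: ifP => // _]; rewrite andbC.
Qed.

Lemma dc_adj_irr : irreflexive (@dc_adj n).
Proof.
by move=> u; apply/existsP => -[i /andP[/forallP/(_ i)]]; rewrite !eqxx.
Qed.

Lemma to_dc_adj : {homo to_dc : s t / dadj s t >-> dc_adj s t}.
Proof.
have flip_eq (j j' : 'I_k) (x : {set 'I_k}) : ((j \in x) == (j \in flip j' x)) = (j != j').
  by rewrite inE; case: (j == j'); case: (j \in x).
have yx j j' : (idx_y j == idx_x j') = false.
  by rewrite -val_eqE /=; apply/negbTE; rewrite neq_ltn orbC (leq_trans (ltn_ord j')) // leq_addr.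
have bx j' : (idx_b == idx_x j') = false.
  by rewrite -val_eqE /=; apply/negbTE; rewrite neq_ltn orbC (leq_trans (ltn_ord j')) // leq_addr.
have by_ j' : (idx_b == idx_y j') = false.
  by rewrite -val_eqE /= eqn_add2l; apply/negbTE; rewrite neq_ltn orbC ltn_ord.
have xx j j' : (idx_x j == idx_x j') = (j == j') by rewrite -!val_eqE.
have yy j j' : (idx_y j == idx_y j') = (j == j') by rewrite -!val_eqE /= eqn_add2l.
have along_x x y i : dc_adj (to_dc (false, x, y)) (to_dc (false, flip i x, y)).
  rewrite dc_adjE; apply/existsP; exists (idx_x i); rewrite !to_dc_b /= ltn_ord andbT.
  apply/forallP => r; case: (idxP r) => [j|j|]; rewrite ?to_dc_x ?to_dc_y ?to_dc_b ?flip_eq.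
  - by rewrite xx eqxx.
  - by rewrite yx !eqxx.
  by rewrite bx !eqxx.
have along_y x y i : dc_adj (to_dc (true, x, y)) (to_dc (true, x, flip i y)).
  rewrite dc_adjE; apply/existsP; exists (idx_y i); rewrite !to_dc_b /= ltnNge leq_addr /= ltn_add2l ltn_ord andbT.
  apply/forallP => r; case: (idxP r) => [j|j|]; rewrite ?to_dc_x ?to_dc_y ?to_dc_b ?flip_eq.
  - by rewrite eq_sym (eq_sym (idx_x j)) yx !eqxx.
  - by rewrite yy eqxx.
  by rewrite by_ !eqxx.
have across b x y : dc_adj (to_dc (b, x, y)) (to_dc (~~ b, x, y)).
  rewrite dc_adjE; apply/existsP; exists idx_b; rewrite !to_dc_b /= ltnNge leq_addr ltnn andbT.
  apply/forallP => r; case: (idxP r) => [j|j|]; rewrite ?to_dc_x ?to_dc_y ?to_dc_b.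
  - by rewrite (eq_sym (idx_x j)) bx !eqxx.
  - by rewrite (eq_sym (idx_y j)) by_ !eqxx.
  by rewrite eqxx; case: b.
move=> [[[] x] y] [[[] x'] y'] /= /andP[/eqP->].
- by case/exists_inP=> j _ /eqP->.
- by move/eqP->; apply: (across true).
- by move/eqP->; apply: (across false).
by case/exists_inP=> j _ /eqP->.
Qed.

(** A neighbour is determined by the flipped bit: the class bit, coded by [None], or one of the [k]
    bits that the class of [u] leaves free. *)
Lemma dc_degree (u : dc_vertex n) : #|dc_adj u| <= n.
Proof.
pose nbr (o : option 'I_k) : dc_vertex n :=
  let i := if o is Some j then if u idx_b then idx_y j else idx_x j else idx_b in
  [ffun r => u r (+) (r == i)].
have sub : dc_adj u \subset codom nbr.
  apply/subsetP => v vu; have : dc_adj u v := vu; rewrite dc_adjE => /existsP[i /andP[/forallP uv ub]].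
  have vE : v = [ffun r => u r (+) (r == i)].
    by apply/ffunP => r; rewrite ffunE; move: (uv r); case: (r == i); case: (u r); case: (v r).
  case: (idxP i) ub vE => [j|j|].
  - rewrite /= ltn_ord => /andP[/negbTE ub _] ->; apply/codomP; exists (Some j).
    by rewrite /nbr ub.
  - rewrite /= ltnNge leq_addr /= ltn_add2l ltn_ord => /andP[ub _] ->.
    by apply/codomP; exists (Some j); rewrite /nbr ub.
  by move=> _ ->; apply/codomP; exists None.
apply: leq_trans (subset_leq_card sub) _; apply: leq_trans (card_size _) _.
by rewrite size_codom card_option card_ord.
Qed.

Lemma dc_has_S_trees (S : {set dc_vertex n}) : 2 < k -> #|S| = 4 -> has_S_trees (@dc_adj n) S k.
Proof.
move=> k3 S4; have I3 : 2 < #|'I_k| by rewrite card_ord.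
have szE : size (map of_dc (enum S)) = 4 by rewrite size_map -cardE.
have := routable_map to_dcK of_dcK to_dc_adj (routable_size4 I3 szE).
rewrite -map_comp (eq_map (g := id)) ?map_id; last exact: of_dcK.
move/(routable_has_S_trees dc_adj_sym dc_adj_irr); rewrite set_enum; apply.
by apply: contraPneq S4 => e; rewrite cardE e.
Qed.

(** The set consists of a vertex and three of its neighbours; the bound comes from the adjacent pair
    [u], [v r0]. *)
Lemma dc_tight_set : 2 < k -> exists S : {set dc_vertex n},
  #|S| = 4 /\ forall m, has_S_trees (@dc_adj n) S m -> m < n.
Proof.
move=> k3; pose u : dc_vertex n := to_dc (false, set0, set0).
pose v (r : 'I_k) : dc_vertex n := to_dc (false, flip r set0, set0).
pose r0 := Ordinal (ltnW (ltnW k3)); pose r1 := Ordinal (ltnW k3); pose r2 := Ordinal k3.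
pose s := [:: u; v r0; v r1; v r2].
have us : uniq s.
  rewrite -[s]/(map to_dc [seq (false, x, set0) | x <- [:: set0; flip r0 set0; flip r1 set0; flip r2 set0]]).
  rewrite (map_inj_uniq (can_inj to_dcK)) map_inj_uniq => [|x x' [] //].
  have flip0 (r r' : 'I_k) : (flip r set0 == flip r' set0) = (r == r').
    apply/eqP/eqP => [/setP/(_ r)|->//]; rewrite !inE eqxx /=.
    by case: eqP.
  by rewrite /= !inE !flip0 ![set0 == _]eq_sym !(negbTE (flip_neq _ _)).
exists [set x in s]; have S4 : #|[set x in s]| = 4 by rewrite cardsE (card_uniqP us).
split=> // m; apply: (@has_S_trees_lt_degree _ _ dc_adj_sym _ u (v r0)); rewrite ?S4 ?dc_degree //.
- by rewrite !inE eqxx.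
- by rewrite !inE eqxx orbT.
by apply: to_dc_adj; rewrite /= eqxx qadj_flip ?inE.
Qed.

End DualCubeGraph.

Lemma bigmin_le (J : finType) (P : pred J) (F : J -> nat) (d : nat) (j : J) :
  P j -> \big[minn/d]_(i | P i) F i <= F j.
Proof.
move=> Pj; rewrite -big_filter; have : j \in [seq i <- index_enum J | P i].
  by rewrite mem_filter Pj mem_index_enum.
elim: [seq _ <- _ | _] => // i l IH; rewrite big_cons inE => /orP[/eqP->|/IH].
  exact: geq_minl.
by apply: leq_trans; apply: geq_minr.
Qed.

Lemma kappaS_lt (T : finType) (adj : rel T) (S : {set T}) d :
  0 < d -> (forall m, has_S_trees adj S m -> m < d) -> kappaS adj S < d.
Proof.
by case: d => // d _ H; rewrite ltnS; apply/bigmax_leqP => m /H.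
Qed.

Lemma kappaS_ge (T : finType) (adj : rel T) (S : {set T}) m :
  m <= #|{set T}| -> has_S_trees adj S m -> m <= kappaS adj S.
Proof.
by rewrite -ltnS => le H; apply: (leq_bigmax_cond (Ordinal le) H).
Qed.

Theorem mainTheorem6 (n : nat) : 4 <= n -> kappa_r (@dc_adj n) 4 = n - 1.
Proof.
case: n => // k k3; rewrite subn1 /=.
(* Needed twice: [kappaS] is a maximum bounded by this cardinal, and the minimum in [kappa_r] has it
   as default. It exceeds [k] because singletons already number [2 ^ (2k + 1)]. *)
have k_le : k <= #|{set dc_vertex k.+1}|.
  apply: leq_trans (leq_card _ (@set1_inj (dc_vertex k.+1))).
  rewrite card_ffun card_bool card_ord dim_eq; apply: leq_trans (ltnW (ltn_expl k (isT : 1 < 2))) _.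
  by rewrite leq_exp2l // -addnA leq_addr.
apply/eqP; rewrite eqn_leq; apply/andP; split.
  have [S [S4 HS]] := dc_tight_set k3; rewrite -ltnS.
  apply: leq_ltn_trans (bigmin_le _ _ _) (kappaS_lt _ HS) => //; exact/eqP.
apply: (big_ind (fun x => k <= x)) => // [x y|S /eqP S4]; first by rewrite leq_min => -> ->.
by apply: kappaS_ge => //; apply: dc_has_S_trees.
Qed.
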